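(* Let $T$ be a real-valued, zero mean, $2$-weakly isotropic Gaussian random field on the unit sphere $\mathbb{S}^2\subset\mathbb{R}^3$ whose angular power spectrum $(C_\ell,\ell\in\mathbb{N}_0)$ is of the form $C_\ell=\prod_{i=1}^M(\kappa_i+\ell(\ell+1))^{-1}$ for all $\ell\in\mathbb{N}_0$, with $M\in\mathbb{N}$ and $\kappa_1,\dots,\kappa_M\in\mathbb{C}$. For $m\in\mathbb{Z}$ and $z=\cos\theta\in[-1,1]$ with $\theta\in[0,\pi]$, set $$g_m(z):=\frac{1}{2\pi}\int_0^{2\pi}T(\theta,\phi)\,e^{-im\phi}\,\mathrm{d}\phi .$$ Then the sequence $(g_m,\,m\in\mathbb{N}_0)$ consists of pairwise independent centred Gaussian random fields on $[-1,1]$ with covariance given, for $z_1,z_2\in[-1,1]$, by $$C_{g_m}(z_1,z_2):=\mathbb{E}\big(\overline{g_m(z_1)}\,g_m(z_2)\big)=\sum_{\ell\ge|m|}C_\ell\,L_{\ell m}(z_1)\,L_{\ell m}(z_2),$$ while the functions $(g_m,\,m<0)$ with negative index are determined by the relation $g_m=\overline{g_{-m}}$.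
   Context: Points of $\mathbb{S}^2$ are written in spherical coordinates $(\theta,\phi)\in[0,\pi]\times[0,2\pi)$ (inclination and azimuth). Legendre polynomials: $P_\ell(\mu)=2^{-\ell}\frac{1}{\ell!}\frac{\partial^\ell}{\partial\mu^\ell}(\mu^2-1)^\ell$ for $\ell\in\mathbb{N}_0$. Associated Legendre polynomials: $P_{\ell m}(\mu)=(-1)^m(1-\mu^2)^{m/2}\frac{\partial^m}{\partial\mu^m}P_\ell(\mu)$ for $m=0,\dots,\ell$, $\mu\in[-1,1]$, and $P_{\ell m}=(-1)^{|m|}\frac{(\ell-|m|)!}{(\ell+|m|)!}P_{\ell,-m}$ for $m=-\ell,\dots,-1$. Define $$L_{\ell m}(z):=\sqrt{\frac{2\ell+1}{4\pi}\frac{(\ell-m)!}{(\ell+m)!}}\,P_{\ell m}(z).$$ Spherical harmonics: $Y_{\ell m}(\theta,\phi)=L_{\ell m}(\cos\theta)e^{im\phi}$ for $m=0,\dots,\ell$, and $Y_{\ell m}=(-1)^m\overline{Y_{\ell,-m}}$ for $m=-\ell,\dots,-1$. The field $T$ is taken with its known expansion $T=\sum_{\ell=0}^\infty\sum_{m=-\ell}^{\ell}a_{\ell m}Y_{\ell m}$, where the $a_{\ell m}$ are complex-valued centred Gaussian random variables such that: (1) $(a_{\ell m},\ \ell\in\mathbb{N}_0,\ m=0,\dots,\ell)$ are independent; (2) for $m>0$, $\operatorname{Re}a_{\ell m}$ and $\operatorname{Im}a_{\ell m}$ are independent and $\mathcal{N}(0,C_\ell/2)$ distributed; (3) for $m=0$,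 $a_{\ell 0}$ is real-valued and $\mathcal{N}(0,C_\ell)$ distributed; (4) for $m<0$, $a_{\ell m}=(-1)^m\,\overline{a_{\ell,-m}}$. The sequence $(C_\ell)$ (nonnegative reals) is called the angular power spectrum of $T$. The expansion converges in $L^2(\Omega\times\mathbb{S}^2)$ and, for each fixed point of $\mathbb{S}^2$, in $L^2(\Omega)$; $T$ having finite variance means $\sum_\ell(2\ell+1)C_\ell<\infty$. For $m\neq0$ the fields $g_m$ are complex-valued. *)

(* Defs.v *)
From HB Require Import structures.
From mathcomp Require Import all_boot all_order all_algebra.
From mathcomp Require Import all_classical all_reals all_analysis.
From mathcomp Require Import complex.

Set Implicit Arguments.
Unset Strict Implicit.
Unset Printing Implicit Defensive.

Import Order.TTheory GRing.Theory Num.Theory.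
Import numFieldNormedType.Exports.

Local Open Scope classical_set_scope.
Local Open Scope ring_scope.
Local Open Scope complex_scope.

Local Notation Re := complex.Re.
Local Notation Im := complex.Im.

Section SphericalHarmonics.
Variable R : realType.

Definition legendre (l : nat) : {poly R} :=
  (2 ^- l / (l`!)%:R) *: (('X ^+ 2 - 1) ^+ l)^`(l).

Definition legendre_nat (l m : nat) (mu : R) : R :=
  (-1) ^+ m * (1 - mu ^+ 2) `^ (m%:R / 2) * ((legendre l)^`(m)).[mu].

Definition assoc_legendre (l : nat) (m : int) (mu : R) : R :=
  match m with
  | Posz k => legendre_nat l k mu
  | Negz k => (-1) ^+ k.+1 * ((l - k.+1)`!)%:R / ((l + k.+1)`!)%:R
              * legendre_nat l k.+1 mu
  end.

(* Only meant for - l <= m <= l, where l - m and l + m are nonnegative and the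
   absolute values are immaterial. *)
Definition Llm (l : nat) (m : int) (z : R) : R :=
  Num.sqrt ((2 * l + 1)%:R / (4 * pi)
            * ((absz (l%:Z - m))`!)%:R / ((absz (l%:Z + m))`!)%:R)
  * assoc_legendre l m z.

Definition expi (x : R) : R[i] := cos x +i* sin x.

Definition Ynat (l m : nat) (theta phi : R) : R[i] :=
  (Llm l m (cos theta))%:C * expi (m%:R * phi).

Definition Ylm (l : nat) (m : int) (theta phi : R) : R[i] :=
  match m with
  | Posz k => Ynat l k theta phi
  | Negz k => (-1) ^+ k.+1 * conjc (Ynat l k.+1 theta phi)
  end.

End SphericalHarmonics.

Section Sphere.
Variable R : realType.

(* R^3 is the iterated product, which carries the product (= Borel)
   sigma-algebra. *)
Definition sphere : set (R * R * R) :=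
  [set x | x.1.1 ^+ 2 + x.1.2 ^+ 2 + x.2 ^+ 2 = 1].

Definition spoint (theta phi : R) : R * R * R :=
  (sin theta * cos phi, sin theta * sin phi, cos theta).

Definition SO3 : set 'M[R]_3 := [set Q | Q *m Q^T = 1%:M /\ \det Q = 1].

Definition rotate (Q : 'M[R]_3) (x : R * R * R) : R * R * R :=
  let y := Q *m (\col_(i < 3) [:: x.1.1; x.1.2; x.2]`_i) in
  (y 0 0, y 1 0, y 2 0).

End Sphere.

Definition segment11 (R : realType) : set R := [set z | -1 <= z <= 1].

Section Probability.
Variables (R : realType) (d : measure_display) (Omega : measurableType d).
Variable P : probability Omega R.

Definition cpair (z : R[i]) : R * R := (Re z, Im z).

(* The case v = 0 is the Dirac mass at m: the library's normal_prob takes the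
   standard deviation and is the uniform law on [0, 1] when this is 0. *)
Definition normal_law (m v : R) (A : set R) : \bar R :=
  if v == 0 then \d_m A else normal_prob m (Num.sqrt v) A.

Definition has_normal_law (X : Omega -> R) (m v : R) : Prop :=
  measurable_fun setT X /\
  forall A : set R, measurable A -> P (X @^-1` A) = normal_law m v A.

Definition gaussian_rv (X : Omega -> R) : Prop :=
  exists m v : R, 0 <= v /\ has_normal_law X m v.

Definition independent_rv (X Y : Omega -> R) : Prop :=
  forall A B : set R, measurable A -> measurable B ->
    P (X @^-1` A `&` Y @^-1` B) = (P (X @^-1` A) * P (Y @^-1` B))%E.

Definition mutually_independent (I : eqType) (D : set I)
    (X : I -> Omega -> R[i]) : Prop :=
  forall (s : seq I) (B : I -> set (R * R)),
    uniq s -> (forall i, i \in s -> D i) -> (forall i, measurable (B i)) ->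
    P [set w | forall i, i \in s -> B i (cpair (X i w))] =
    (\prod_(i <- s) P [set w | B i (cpair (X i w))])%E.

Definition cexpectation (X : Omega -> R[i]) : R[i] :=
  fine ('E_P[fun w => Re (X w)])%E +i* fine ('E_P[fun w => Im (X w)])%E.

Definition cintegrable (X : Omega -> R[i]) : Prop :=
  P.-integrable setT (fun w => (Re (X w))%:E) /\
  P.-integrable setT (fun w => (Im (X w))%:E).

Section Fields.
Variables (dS : measure_display) (S : measurableType dS) (D : set S).

Definition random_field (X : S -> Omega -> R[i]) : Prop :=
  measurable_fun (D `*` [set: Omega])
    (fun p : S * Omega => cpair (X p.1 p.2)).

(* Every finite family of real and imaginary parts is jointly Gaussian, i.e.
   all its real linear combinations are Gaussian. *)
Definition gaussian_field (X : S -> Omega -> R[i]) : Prop :=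
  random_field X /\
  forall (k : nat) (x : 'I_k -> S) (b c : 'I_k -> R),
    (forall j, D (x j)) ->
    gaussian_rv (fun w =>
      \sum_(j < k) (b j * Re (X (x j) w) + c j * Im (X (x j) w))).

Definition centred_field (X : S -> Omega -> R[i]) : Prop :=
  forall x, D x ->
    ('E_P[fun w => Re (X x w)] = 0 /\ 'E_P[fun w => Im (X x w)] = 0)%E.

Definition field_events (X : S -> Omega -> R[i]) : set (set Omega) :=
  <<s [set A | exists x (B : set (R * R)),
        [/\ D x, measurable B & A = [set w | B (cpair (X x w))]] ] >>.

Definition independent_fields (X Y : S -> Omega -> R[i]) : Prop :=
  forall A B, field_events X A -> field_events Y B ->
    P (A `&` B) = (P A * P B)%E.

End Fields.

Definition weakly_isotropic (n : nat) (T : R * R * R -> Omega -> R) : Prop :=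
  (forall x, sphere x -> (\int[P]_w (`|T x w| ^+ n)%:E < +oo)%E) /\
  forall (k : nat) (x : 'I_k -> R * R * R) (Q : 'M[R]_3),
    (1 <= k <= n)%N -> (forall j, sphere (x j)) -> SO3 Q ->
    ('E_P[fun w => (\prod_(j < k) T (x j) w)%R] =
     'E_P[fun w => (\prod_(j < k) T (rotate Q (x j)) w)%R])%E.

Definition partial_sum (a : nat -> int -> Omega -> R[i]) (n : nat)
    (theta phi : R) (w : Omega) : R[i] :=
  \sum_(l < n) \sum_(j < (2 * l).+1)
    a l (j%:Z - l%:Z) w * Ylm l (j%:Z - l%:Z) theta phi.

Definition sq_error (T : R * R * R -> Omega -> R)
    (a : nat -> int -> Omega -> R[i]) (n : nat) (theta phi : R) : \bar R :=
  (\int[P]_w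
     (Normc.normc ((T (spoint theta phi) w)%:C
                   - partial_sum a n theta phi w) ^+ 2)%:E)%E.

Record harmonic_coefficients (C : nat -> R)
    (a : nat -> int -> Omega -> R[i]) : Prop := {
  coef_measurable : forall (l : nat) (m : int), `|m| <= l%:Z ->
    measurable_fun setT (fun w => cpair (a l m w)) ;
  coef_independent :
    mutually_independent [set lm : nat * nat | (lm.2 <= lm.1)%N]
      (fun lm => a lm.1 lm.2%:Z) ;
  coef_pos : forall l m : nat, (0 < m <= l)%N ->
    [/\ independent_rv (fun w => Re (a l m w)) (fun w => Im (a l m w)),
        has_normal_law (fun w => Re (a l m w)) 0 (C l / 2) &
        has_normal_law (fun w => Im (a l m w)) 0 (C l / 2)] ;
  coef_zero : forall l : nat,
    {ae P, forall w, Im (a l 0 w) = 0} /\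
    has_normal_law (fun w => Re (a l 0 w)) 0 (C l) ;
  coef_neg : forall l m : nat, (0 < m <= l)%N ->
    {ae P, forall w, a l (- m%:Z) w = (-1) ^+ m * conjc (a l m%:Z w)}
}.

(* The surface measure of the sphere is sin theta dtheta dphi. *)
Definition harmonic_expansion (T : R * R * R -> Omega -> R)
    (a : nat -> int -> Omega -> R[i]) : Prop :=
  ((\int[lebesgue_measure]_(theta in `[0%R, pi])
      \int[lebesgue_measure]_(phi in `[0%R, (2 * pi)%R])
        (sq_error T a n theta phi * (sin theta)%:E))%E
     @[n --> \oo] --> 0%E) /\
  (forall theta phi : R, 0 <= theta <= pi -> 0 <= phi < 2 * pi ->
     sq_error T a n theta phi @[n --> \oo] --> 0%E).

Definition angular_power_spectrum (T : R * R * R -> Omega -> R)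
    (C : nat -> R) : Prop :=
  [/\ forall l, 0 <= C l,
      cvgn (series (fun l => (2 * l + 1)%:R * C l)) &
      exists a : nat -> int -> Omega -> R[i],
        harmonic_coefficients C a /\ harmonic_expansion T a].

(* acos z is the unique theta in [0, pi] with cos theta = z. *)
Definition gfield (T : R * R * R -> Omega -> R) (m : int) (z : R) (w : Omega)
    : R[i] :=
  let f (phi : R) := (T (spoint (acos z) phi) w)%:C * expi (- (m%:~R * phi)) in
  ((2 * pi)^-1)%:C *
  ((\int[lebesgue_measure]_(phi in `[0, 2 * pi]) Re (f phi))%R +i*
   (\int[lebesgue_measure]_(phi in `[0, 2 * pi]) Im (f phi))%R).

End Probability.

(* Main.v *)
(* Fix z = cos theta and let |.| be the norm of L2(Omega). The increments of the
   partial sums S_n of the expansion have second moments that do not depend on phi,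
   so S_n converges to T in L2(Omega) uniformly on the circle of latitude theta.
   Hence, up to |T(theta, 0) - S_n(theta, 0)|, both g_m(z) and the discrete Fourier
   coefficient of T over N > n + m equidistant points of this circle agree with the
   m-th Fourier coefficient h_n = sum_(m <= l < n) a_lm L_lm(z) of S_n.
   - The discrete coefficients are linear combinations of values of T, so g_m is an
     L2-limit of centred Gaussian variables, hence centred Gaussian.
   - The covariance of g_m is the limit of the covariances of the h_n.
   - g_m(z) is almost surely a function of the (a_lm, l >= m), and these families
     are independent for distinct m. *)
Require Import Defs.
From HB Require Import structures.
From mathcomp Require Import all_boot all_order all_algebra.
From mathcomp Require Import all_classical all_reals all_analysis.
From mathcomp Require Import measurable_realfun complex zify ring lra.

Set Implicit Arguments.
Unset Strict Implicit.
Unset Printing Implicit Defensive.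

Import Order.TTheory GRing.Theory Num.Theory.
Import numFieldNormedType.Exports.

Local Open Scope classical_set_scope.
Local Open Scope ring_scope.
Local Open Scope complex_scope.

(** * The space L2 *)

Section SquareIntegrable.
Context {d : measure_display} {T : measurableType d} {R : realType}.
Variable mu : {measure set T -> \bar R}.
Implicit Types (X Y Z : T -> R) (c : R).

Definition L2 : {pred T -> R} := Lfun mu 2%:E.

HB.instance Definition _ := GRing.isSubmodClosed.Build R (T -> R) L2
  (Lfun_submod_closed mu (lee1n 2)).

Definition l2dot X Y : R := \int[mu]_x (X x * Y x).

Definition l2norm X : R := fine ('N[mu]_2%:E[EFin \o X])%E.

Lemma measurable_L2 X : X \in L2 -> measurable_fun setT X.
Proof. by move=> /sub_Lfun_mfun /set_mem. Qed.

Lemma L2P X : X \in L2 <->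
  measurable_fun setT X /\ (\int[mu]_x (X x ^+ 2)%:E < +oo)%E.
Proof.
split=> [XL2|[mX Xfin]].
  split; first exact: measurable_L2.
  have /integrableP[_] := Lfun2_integrable_sqr XL2.
  by under eq_integral do rewrite /= ger0_norm ?sqr_ge0//.
apply/andP; split; apply/mem_set => //; rewrite /finite_norm unlock.
apply: poweR_lty; under eq_integral do rewrite /= powR_mulrn// real_normK ?num_real//.
exact: Xfin.
Qed.

Lemma integrableM_L2 X Y : X \in L2 -> Y \in L2 ->
  mu.-integrable setT (fun x => (X x * Y x)%:E).
Proof. by move=> XL2 YL2; exact/Lfun1_integrable/Lfun2_mul_Lfun1. Qed.

Lemma Lnorm2_fin_num X : X \in L2 -> 'N[mu]_2%:E[EFin \o X]%E \is a fin_num.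
Proof.
move=> /sub_Lfun_finLfun /set_mem Xfin.
by rewrite ge0_fin_numE ?Lnorm_ge0.
Qed.

Lemma sqr_l2norm X : X \in L2 -> l2norm X ^+ 2 = l2dot X X.
Proof.
move=> XL2; have := poweR_Lnorm mu (EFin \o X) (_ : 2 != 0 :> R).
rewrite pnatr_eq0 => /(_ isT) norm2; apply: EFin_inj.
rewrite -powR_mulrn ?fine_ge0 ?Lnorm_ge0// -poweR_EFin fineK ?Lnorm2_fin_num//.
rewrite norm2 /l2dot /Rintegral fineK ?(integrable_fin_num measurableT)//.
  by apply: eq_integral => x _ /=; rewrite powR_mulrn// real_normK ?num_real.
exact: integrableM_L2.
Qed.

Lemma EFin_sqr_l2norm X : X \in L2 ->
  ((l2norm X ^+ 2)%:E = \int[mu]_x (X x ^+ 2)%:E)%E.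
Proof.
move=> XL2; rewrite sqr_l2norm// /l2dot /Rintegral fineK.
  by apply: eq_integral => x _; rewrite expr2.
exact/(integrable_fin_num measurableT)/integrableM_L2.
Qed.

Lemma l2norm_ge0 X : 0 <= l2norm X.
Proof. by rewrite fine_ge0 ?Lnorm_ge0. Qed.

Lemma l2norm_le X c : measurable_fun setT X -> 0 <= c ->
  (\int[mu]_x (X x ^+ 2)%:E <= (c ^+ 2)%:E)%E -> X \in L2 /\ l2norm X <= c.
Proof.
move=> mX c0 Xc; have XL2 : X \in L2.
  by apply/L2P; split=> //; exact: le_lt_trans Xc (ltry _).
split=> //; rewrite -(@ler_pXn2r _ 2)// ?nnegrE ?l2norm_ge0//.
by rewrite -lee_fin EFin_sqr_l2norm.
Qed.

Lemma l2dotC X Y : l2dot X Y = l2dot Y X.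
Proof. by apply: eq_Rintegral => x _; rewrite mulrC. Qed.

Lemma l2dot0l X : l2dot 0 X = 0.
Proof.
by rewrite /l2dot; under eq_Rintegral do rewrite mul0r; rewrite Rintegral_cst ?mul0r.
Qed.

Lemma l2dotDl X Y Z : X \in L2 -> Y \in L2 -> Z \in L2 ->
  l2dot (X + Y) Z = l2dot X Z + l2dot Y Z.
Proof.
move=> XL2 YL2 ZL2; rewrite /l2dot -RintegralD//; try exact: integrableM_L2.
by apply: eq_Rintegral => x _; rewrite -mulrDl.
Qed.

Lemma l2dotZl c X Y : X \in L2 -> Y \in L2 -> l2dot (c *: X) Y = c * l2dot X Y.
Proof.
move=> XL2 YL2; rewrite /l2dot -RintegralZl//; last exact: integrableM_L2.
by apply: eq_Rintegral => x _; rewrite mulrA.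
Qed.

Lemma l2dotBl X Y Z : X \in L2 -> Y \in L2 -> Z \in L2 ->
  l2dot (X - Y) Z = l2dot X Z - l2dot Y Z.
Proof.
by move=> XL2 YL2 ZL2; rewrite -scaleN1r l2dotDl ?rpredZ// l2dotZl// mulN1r.
Qed.

Lemma l2dot_suml (I : Type) (r : seq I) (Q : pred I) (F : I -> T -> R) X :
  (forall i, Q i -> F i \in L2) -> X \in L2 ->
  l2dot (\sum_(i <- r | Q i) F i) X = \sum_(i <- r | Q i) l2dot (F i) X.
Proof.
move=> FL2 XL2; elim: r => [|i r IH]; first by rewrite !big_nil l2dot0l.
rewrite !big_cons; case: ifPn => // Qi.
by rewrite l2dotDl ?IH ?FL2 ?rpred_sum.
Qed.

Lemma l2dot_orthogonal_sum (I : eqType) (r : seq I) (x y : I -> R) (F G : I -> T -> R) :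
  uniq r -> {in r, forall i, F i \in L2} -> {in r, forall i, G i \in L2} ->
  {in r &, forall i j, i != j -> l2dot (F i) (G j) = 0} ->
  l2dot (\sum_(i <- r) x i *: F i) (\sum_(i <- r) y i *: G i) =
  \sum_(i <- r) x i * y i * l2dot (F i) (G i).
Proof.
move=> ur FL2 GL2 orthoFG; rewrite big_seq.
rewrite l2dot_suml => [|i ir|]; last 2 first.
- by rewrite rpredZ ?FL2.
- by rewrite big_seq rpred_sum// => i ir; rewrite rpredZ ?GL2.
rewrite [RHS]big_seq; apply: eq_bigr => i ir.
rewrite l2dotC big_seq l2dot_suml => [|j jr|]; last 2 first.
- by rewrite rpredZ ?GL2.
- by rewrite rpredZ ?FL2.
rewrite -big_seq (bigD1_seq i)//= big_seq_cond big1 ?addr0 => [|j /andP[jr ji]].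
  by rewrite l2dotZl ?rpredZ ?FL2 ?GL2// l2dotC l2dotZl ?FL2 ?GL2// mulrCA mulrA.
rewrite l2dotZl ?rpredZ ?FL2 ?GL2// l2dotC l2dotZl ?FL2 ?GL2//.
by rewrite orthoFG ?mulr0// eq_sym.
Qed.

Lemma cauchy_schwarz X Y : X \in L2 -> Y \in L2 ->
  `|l2dot X Y| <= l2norm X * l2norm Y.
Proof.
move=> XL2 YL2; have [mX mY] := (measurable_L2 XL2, measurable_L2 YL2).
rewrite -lee_fin EFinM !fineK ?Lnorm2_fin_num//.
apply: le_trans (hoelder mu mX mY _ _ _) => //; last by rewrite [RHS]splitr !div1r.
rewrite Lnorm1 EFin_normr_Rintegral//; last exact: integrableM_L2.
by apply: le_abse_integral => //; apply/measurable_EFinP/measurable_funM.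
Qed.

Lemma l2norm0 : l2norm 0 = 0.
Proof.
by apply/eqP; rewrite -sqrf_eq0 sqr_l2norm ?rpred0 ?l2dot0l.
Qed.

Lemma l2normZ c X : X \in L2 -> l2norm (c *: X) = `|c| * l2norm X.
Proof.
move=> XL2; apply/eqP; rewrite -(@eqrXn2 _ 2)// ?mulr_ge0 ?l2norm_ge0//.
rewrite exprMn !sqr_l2norm ?rpredZ// l2dotZl ?rpredZ// l2dotC l2dotZl//.
by rewrite real_normK ?num_real// mulrA expr2.
Qed.

Lemma ler_l2normD X Y : X \in L2 -> Y \in L2 ->
  l2norm (X + Y) <= l2norm X + l2norm Y.
Proof.
move=> XL2 YL2; rewrite -lee_fin EFinD !fineK ?Lnorm2_fin_num ?rpredD//.
by apply: minkowski_EFin; rewrite ?ler1n//; exact: measurable_L2.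
Qed.

Lemma ler_l2norm_sum (I : Type) (r : seq I) (F : I -> T -> R) :
  (forall i, F i \in L2) ->
  l2norm (\sum_(i <- r) F i) <= \sum_(i <- r) l2norm (F i).
Proof.
move=> FL2; elim: r => [|i r IH]; first by rewrite !big_nil l2norm0.
rewrite !big_cons; apply: le_trans (ler_l2normD _ _) _ => //.
  by rewrite rpred_sum.
by rewrite lerD2l.
Qed.

Lemma l2norm_polarization X Y : X \in L2 -> Y \in L2 ->
  l2norm (X + Y) ^+ 2 - l2norm (X - Y) ^+ 2 = 4 * l2dot X Y.
Proof.
move=> XL2 YL2; have [XDL2 XBL2] := (rpredD XL2 YL2, rpredB XL2 YL2).
rewrite !sqr_l2norm// l2dotBl// l2dotDl// ![l2dot _ (X + Y)]l2dotC.
by rewrite ![l2dot _ (X - Y)]l2dotC !l2dotBl// !l2dotDl// [l2dot Y X]l2dotC; lra.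
Qed.

Lemma l2normBC X Y : X \in L2 -> Y \in L2 -> l2norm (X - Y) = l2norm (Y - X).
Proof.
by move=> XL2 YL2; rewrite -opprB -scaleN1r l2normZ ?rpredB// normrN1 mul1r.
Qed.

Lemma ler_l2norm_dist X Y : X \in L2 -> Y \in L2 ->
  `|l2norm X - l2norm Y| <= l2norm (X - Y).
Proof.
move=> XL2 YL2; have := ler_l2normD (rpredB XL2 YL2) YL2.
have := ler_l2normD (rpredB YL2 XL2) XL2.
by rewrite !subrK l2normBC// => XY YX; rewrite ler_norml; apply/andP; split; lra.
Qed.

Lemma ae_eq_l2norm X Y : measurable_fun setT X -> measurable_fun setT Y ->
  {ae mu, forall x, X x = Y x} -> l2norm X = l2norm Y.
Proof.
move=> mX mY XY; rewrite /l2norm unlock; congr (fine (_ `^ _)).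
have mn Z : measurable_fun setT Z ->
    measurable_fun setT (fun x => (`|Z x| `^ 2)%:E).
  move=> mZ; apply/measurable_EFinP; apply: (measurableT_comp (measurable_powR 2)).
  exact: measurableT_comp.
apply: ae_eq_integral => //; [exact: mn..|].
by move: XY; apply: filterS => x /= -> _.
Qed.

Lemma l2norm_eq0 X : X \in L2 -> l2norm X = 0 -> {ae mu, forall x, X x = 0}.
Proof.
move=> XL2 X0; have : 'N[mu]_2%:E[EFin \o X]%E = 0%E.
  by rewrite -[LHS]fineK ?Lnorm2_fin_num// -/(l2norm X) X0.
have /measurable_EFinP mX := measurable_L2 XL2.
move=> /(Lnorm_eq0_eq0 mX) => /(_ (ltr0n _ _)).
by apply: filterS => x /(_ I) [].
Qed.

End SquareIntegrable.

Lemma squeeze_dist_cvg {R : realType} (u v : nat -> R) (l : R) :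
  (forall n, `|u n - l| <= v n) -> v @ \oo --> 0 -> u @ \oo --> l.
Proof.
move=> uv /cvgrPdist_lt v0; apply/cvgrPdist_lt => e /v0; apply: filterS => n.
rewrite sub0r normrN distrC; apply: le_lt_trans.
exact: le_trans (uv n) (ler_norm _).
Qed.

Section L2Convergence.
Context {d : measure_display} {T : measurableType d} {R : realType}.
Variable mu : {measure set T -> \bar R}.
Implicit Types (X Y : T -> R).
Local Notation L2 := (L2 mu).

Definition l2cvg (X_ : nat -> T -> R) X := l2norm mu (X_ n - X) @[n --> \oo] --> 0.

Lemma l2cvg_cst X : l2cvg (fun=> X) X.
Proof. by rewrite /l2cvg subrr l2norm0; exact: cvg_cst. Qed.

Lemma l2cvg_le (X_ : nat -> T -> R) X (e : nat -> R) :
  (forall n, l2norm mu (X_ n - X) <= e n) -> e @ \oo --> 0 -> l2cvg X_ X.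
Proof.
by move=> Xe; apply: squeeze_dist_cvg => n; rewrite subr0 ger0_norm ?l2norm_ge0.
Qed.

Lemma l2cvgD (X_ Y_ : nat -> T -> R) X Y :
  (forall n, X_ n \in L2) -> (forall n, Y_ n \in L2) -> X \in L2 -> Y \in L2 ->
  l2cvg X_ X -> l2cvg Y_ Y -> l2cvg (fun n => X_ n + Y_ n) (X + Y).
Proof.
move=> X_L2 Y_L2 XL2 YL2 cX cY.
apply: (@l2cvg_le _ _ (fun n => l2norm mu (X_ n - X) + l2norm mu (Y_ n - Y))).
  by move=> n; rewrite opprD addrACA ler_l2normD ?rpredB.
by rewrite -[0]addr0; exact: cvgD.
Qed.

Lemma l2cvgZ (c : R) (X_ : nat -> T -> R) X : (forall n, X_ n \in L2) -> X \in L2 ->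
  l2cvg X_ X -> l2cvg (fun n => c *: X_ n) (c *: X).
Proof.
move=> X_L2 XL2 cX; apply: (@l2cvg_le _ _ (fun n => `|c| * l2norm mu (X_ n - X))).
  by move=> n; rewrite -scalerBr l2normZ ?rpredB.
by rewrite -[0](mulr0 `|c|); apply: cvgM cX; exact: cvg_cst.
Qed.

Lemma l2cvg_norm (X_ : nat -> T -> R) X : (forall n, X_ n \in L2) -> X \in L2 ->
  l2cvg X_ X -> l2norm mu (X_ n) @[n --> \oo] --> l2norm mu X.
Proof.
by move=> X_L2 XL2; apply: squeeze_dist_cvg => n; exact: ler_l2norm_dist.
Qed.

Lemma l2cvg_dot (X_ Y_ : nat -> T -> R) X Y :
  (forall n, X_ n \in L2) -> (forall n, Y_ n \in L2) -> X \in L2 -> Y \in L2 ->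
  l2cvg X_ X -> l2cvg Y_ Y -> l2dot mu (X_ n) (Y_ n) @[n --> \oo] --> l2dot mu X Y.
Proof.
move=> X_L2 Y_L2 XL2 YL2 cX cY; have cnY := l2cvg_norm Y_L2 YL2 cY.
apply: (@squeeze_dist_cvg _ _ (fun n => l2norm mu (X_ n - X) * l2norm mu (Y_ n) +
    l2norm mu (Y_ n - Y) * l2norm mu X)); last first.
  have := cvgD (cvgM cX cnY) (cvgM cY (cvg_cst (l2norm mu X))).
  by rewrite !mul0r addr0; apply.
move=> n; have -> : l2dot mu (X_ n) (Y_ n) - l2dot mu X Y =
    l2dot mu (X_ n - X) (Y_ n) + l2dot mu (Y_ n - Y) X.
  rewrite !l2dotBl// [l2dot _ (Y_ n) X]l2dotC [l2dot _ Y X]l2dotC; lra.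
by apply: le_trans (ler_normD _ _) _; rewrite lerD ?cauchy_schwarz ?rpredB.
Qed.

End L2Convergence.

Section L2Probability.
Context {d : measure_display} {T : measurableType d} {R : realType}.
Variable P : probability T R.
Implicit Types X Y : T -> R.
Local Notation L2 := (L2 P).

Lemma cst_L2 (c : R) : cst c \in L2.
Proof. exact: Lfun_cst. Qed.

Lemma l2dot_cst1 X : l2dot P X (cst 1) = \int[P]_x X x.
Proof. by apply: eq_Rintegral => x _; rewrite mulr1. Qed.

Lemma l2norm_cst1 : l2norm P (cst 1) = 1.
Proof.
apply/eqP; rewrite -(@eqrXn2 _ 2)// ?l2norm_ge0// sqr_l2norm ?cst_L2// l2dot_cst1.
by rewrite Rintegral_cst//= probability_setT mulr1 expr1n.
Qed.

Lemma integrable_L2 X : X \in L2 -> P.-integrable setT (EFin \o X).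
Proof.
move=> XL2; apply: eq_integrable (integrableM_L2 XL2 (cst_L2 1)) => // x _.
by rewrite /= mulr1.
Qed.

Lemma sqr_Rintegral_le X : X \in L2 -> (\int[P]_x X x) ^+ 2 <= l2norm P X ^+ 2.
Proof.
move=> XL2; rewrite -l2dot_cst1 -[leLHS]real_normK ?num_real//.
rewrite ler_pXn2r ?nnegrE ?l2norm_ge0//.
by apply: le_trans (cauchy_schwarz XL2 (cst_L2 1)) _; rewrite l2norm_cst1 mulr1.
Qed.

Lemma l2cvg_Rintegral (X_ : nat -> T -> R) X :
  (forall n, X_ n \in L2) -> X \in L2 -> l2cvg P X_ X ->
  \int[P]_x X_ n x @[n --> \oo] --> \int[P]_x X x.
Proof.
move=> X_L2 XL2 cX; under eq_cvg do rewrite -l2dot_cst1; rewrite -l2dot_cst1.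
by apply: l2cvg_dot => //; [move=> _; exact: cst_L2|exact: cst_L2|exact: l2cvg_cst].
Qed.

Lemma expectation_L2 X : X \in L2 -> ('E_P[X] = (\int[P]_x X x)%:E)%E.
Proof.
move=> /integrable_L2 iX; rewrite unlock /Rintegral fineK//.
exact: (integrable_fin_num measurableT).
Qed.

End L2Probability.

(** * Normal laws *)

Section NormalMoments.
Context {R : realType}.
Local Notation mu := (@lebesgue_measure R).
Local Notation phi := (normal_pdf (0 : R) 1).
Implicit Types m s x t : R.

Lemma ge0_integral_normal_prob m s (f : R -> \bar R) :
  measurable_fun setT f -> (forall x, 0 <= f x)%E ->
  (\int[normal_prob m s]_x f x = \int[mu]_x (f x * (normal_pdf m s x)%:E))%E.
Proof.
move=> mf f0; pose nu : probability _ R := normal_prob m s.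
have nu_mu : nu `<< mu := normal_prob_dominates m s.
rewrite -(Radon_Nikodym_SigmaFinite.change_of_variables nu_mu)//.
have m_pdf : measurable_fun setT (EFin \o normal_pdf m s).
  by apply/measurable_EFinP; exact: measurable_normal_pdf.
have iRN := Radon_Nikodym_SigmaFinite.f_integrable nu_mu.
apply: ae_eq_integral => //.
- by apply: emeasurable_funM => //; exact: (measurable_int mu).
- exact: emeasurable_funM.
- apply: ae_eqe_mul2l; apply: integral_ae_eq => //= E _ mE.
  by rewrite -Radon_Nikodym_SigmaFinite.f_integral.
Qed.

Lemma ge0_integral_affine m s (G : R -> R) :
  0 < s -> continuous G -> (forall x, 0 <= G x) ->
  (\int[mu]_x (G x)%:E = \int[mu]_x (G (s * x + m) * s)%:E)%E.
Proof.
move=> s0 cG G0; pose F x : R := s * x + m.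
have dF x : is_derive x (1 : R) F s.
  by apply: is_derive_eq; rewrite /GRing.scale /= mulr1 addr0.
have F'E : (F^`())%classic = cst s.
  by apply/funext => x; rewrite derive1E derive_val.
rewrite (increasing_ge0_integration_by_substitutionT (F := F))//.
- by apply: eq_integral => x _; rewrite F'E.
- by move=> x y xy; rewrite ltrD2r ltr_pM2l.
- by rewrite F'E => x; exact: cvg_cst.
- by rewrite F'E; exact: is_cvg_cst.
- by rewrite F'E; exact: is_cvg_cst.
- apply: (cvg_comp _ (fun y => y + m)); last exact: cvg_addrr_Ny.
  by apply: gt0_cvgMrNy => //; exact: cvg_id.
- apply: (cvg_comp _ (fun y => y + m)); last exact: cvg_addrr.
  by apply: gt0_cvgMry => //; exact: cvg_id.
Qed.

Lemma normal_pdf_affine m s x : 0 < s -> normal_pdf m s (s * x + m) * s = phi x.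
Proof.
move=> s0; rewrite !normal_pdfE ?oner_neq0 ?gt_eqF// /normal_fun addrK subr0.
have -> : - (s * x) ^+ 2 / (s ^+ 2 *+ 2) = - x ^+ 2 / (1 ^+ 2 *+ 2).
  by field; rewrite gt_eqF.
rewrite mulrAC /normal_peak -!mulrnAr sqrtrM ?sqr_ge0// sqrtr_sqr gtr0_norm//.
by rewrite expr1n mul1r invfM [_ * s]mulrAC mulVf ?mul1r// gt_eqF.
Qed.

Let phiE : phi = fun x => normal_peak 1 * expR (- (x ^+ 2 / 2)).
Proof.
rewrite normal_pdfE ?oner_neq0//; apply/funext => x.
by rewrite /normal_fun subr0 expr1n mulNr.
Qed.

Lemma is_derive_normal_pdf x : is_derive x 1 phi (- (x * phi x)).
Proof.
by rewrite phiE; apply: is_derive_eq; rewrite /GRing.scale /=; field.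
Qed.

Lemma cvg_normal_pdfy : phi x @[x --> +oo] --> 0.
Proof.
have cexp : expR (- (x ^+ 2 / 2)) @[x --> +oo] --> (0 : R).
  apply: (cvg_comp (fun x => x ^+ 2 / 2) (fun y => expR (- y))); last exact: cvgr_expR.
  by apply: gt0_cvgMly; [rewrite invr_gt0|exact: cvgr_expr2].
by have := cvgM (cvg_cst (normal_peak 1)) cexp; rewrite mulr0 phiE; apply.
Qed.

Lemma integral_id_normal_pdf t : 0 <= t ->
  (\int[mu]_(x in `[t, +oo[) (x * phi x)%:E = (phi t)%:E)%E.
Proof.
move=> t0; have dphi x : is_derive x 1 (- phi) (x * phi x).
  rewrite -[x * _]opprK; apply: is_deriveN; exact: is_derive_normal_pdf.
have cphi : continuous (- phi).
  by move=> x; apply: cvgN; apply: continuous_normal_pdf; rewrite oner_neq0.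
rewrite (@ge0_continuous_FTC2y _ _ (- phi) _ 0)//.
- by rewrite sub0e -EFinN opprK.
- by move=> x tx; rewrite mulr_ge0 ?normal_pdf_ge0// (le_trans t0).
- apply: continuous_subspaceT => x; apply: cvgM; first exact: cvg_id.
  by apply: continuous_normal_pdf; rewrite oner_neq0.
- by have := cvgN cvg_normal_pdfy; rewrite oppr0; apply.
- by apply: cvg_at_right_filter; exact: cphi.
- by move=> x _; rewrite derive1E derive_val.
Qed.

Lemma integral_layer_cake (g : R -> R) :
  measurable_fun setT g -> (forall x, 0 <= x -> 0 <= g x) ->
  (\int[mu]_(x in `[0%R, +oo[) (x * g x)%:E =
   \int[mu]_(t in `[0%R, +oo[) \int[mu]_(x in `[t, +oo[) (g x)%:E)%E.
Proof.
move=> mg g0; pose f (p : R * R) : \bar R :=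
  (if (0 <= p.2) && (p.2 <= p.1) then g p.1 else 0)%:E.
have f0 p : (0 <= f p)%E.
  rewrite /f; case: ifPn => // /andP[p0 p12].
  by rewrite lee_fin g0// (le_trans p0).
have mf : measurable_fun setT f.
  apply/measurable_EFinP; apply: measurable_fun_ifT.
  - by apply: measurable_and; apply: measurable_fun_ler.
  - exact: measurableT_comp.
  - exact: measurable_cst.
transitivity (\int[mu]_x \int[mu]_t f (x, t))%E; last first.
  rewrite (@fubini_tonelli _ _ _ _ _ mu mu f)// [RHS]integral_mkcond.
  apply: eq_integral => t _.
  rewrite patchE mem_setE in_itv /= andbT /f /=; case: ifPn => t0.
    rewrite [RHS]integral_mkcond; apply: eq_integral => x _.
    by rewrite patchE mem_setE in_itv /= andbT; case: ifP.
  by rewrite integral0_eq// => x _; rewrite (negbTE t0).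
rewrite [LHS]integral_mkcond; apply: eq_integral => x _.
rewrite patchE mem_setE in_itv /= andbT; case: ifPn => x0; last first.
  rewrite integral0_eq// => t _; rewrite /f /=; case: ifPn => // /andP[t0 tx].
  by rewrite (le_trans t0 tx) in x0.
transitivity (\int[mu]_(t in `[0%R, x]) (g x)%:E)%E.
  rewrite integral_cst//= lebesgue_measure_itv/= lte_fin.
  case: ltgtP x0 => // [x0 _|<- _]; last by rewrite mul0r mule0.
  by rewrite -EFinB subr0 -EFinM mulrC.
rewrite integral_mkcond; apply: eq_integral => t _.
by rewrite patchE mem_setE in_itv /f /=; case: ifP.
Qed.

Lemma integral_sqr_normal_pdf : (\int[mu]_x (x ^+ 2 * phi x)%:E = 1)%E.
Proof.
have cphi : continuous phi by apply: continuous_normal_pdf; rewrite oner_neq0.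
have phiN x : phi x = phi (- x) by rewrite phiE sqrrN.
rewrite -(@integral_normal_pdf R 0 1).
rewrite (ge0_symfun_integralT (f := fun x => x ^+ 2 * phi x)); first last.
- by move=> x; rewrite /comp sqrrN phiN.
- by move=> x; apply: cvgM; [exact: exprn_continuous|exact: cphi].
- by move=> x; rewrite mulr_ge0 ?sqr_ge0 ?normal_pdf_ge0.
rewrite (ge0_symfun_integralT (f := phi))//; last by move=> x; exact: normal_pdf_ge0.
congr (_ * _)%E; rewrite -set_itvcy.
under eq_integral do rewrite expr2 -mulrA.
rewrite (@integral_layer_cake (fun x => x * phi x)).
- apply: eq_integral => t; rewrite mem_setE in_itv /= andbT.
  exact: integral_id_normal_pdf.
- by apply: measurable_funM => //; exact: measurable_normal_pdf.
- by move=> x x0; rewrite mulr_ge0 ?normal_pdf_ge0.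
Qed.

Lemma ge0_integral_oppr (g : R -> R) : continuous g -> (forall x, 0 <= g x) ->
  (\int[mu]_x (g x)%:E = \int[mu]_x (g (- x))%:E)%E.
Proof.
move=> cg g0.
have mgE (h : R -> R) A : continuous h -> measurable_fun A (fun x => (h x)%:E).
  move=> ch; apply/measurable_EFinP/measurable_funTS.
  exact: continuous_measurable_fun.
have cgN : continuous (g \o -%R).
  by move=> x; apply: continuous_comp; [exact: opp_continuous|exact: cg].
have split0 (h : R -> R) : continuous h -> (forall x, 0 <= h x) ->
    (\int[mu]_x (h x)%:E = \int[mu]_(x in `[0%R, +oo[) (h x)%:E +
                           \int[mu]_(x in `[0%R, +oo[) (h (- x))%:E)%E.
  move=> ch h0; rewrite -(setUv `[0%R, +oo[%classic) ge0_integral_setU//=; last 4 first.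
  - exact: measurableC.
  - exact: mgE.
  - by move=> x _; rewrite lee_fin.
  - exact/disj_setPCl.
  rewrite setCitvr integral_itv_bndo_bndc; last exact: mgE.
  have := @ge0_integration_by_substitutionNy R h 0; rewrite oppr0 => ->//.
  exact: continuous_subspaceT.
have := split0 (g \o -%R) cgN (fun x => g0 (- x)); rewrite addeC /= => ->.
rewrite (split0 g)//; congr (_ + _)%E.
by apply: eq_integral => x _; rewrite opprK.
Qed.

Lemma integral_affine_sqr_normal_pdfN s x :
  (\int[mu]_y ((s * y - x) ^+ 2 * phi y)%:E =
   \int[mu]_y ((s * y + x) ^+ 2 * phi y)%:E)%E.
Proof.
have phiN y : phi (- y) = phi y by rewrite phiE sqrrN.
rewrite [RHS]ge0_integral_oppr.
- by apply: eq_integral => y _; rewrite phiN -sqrrN opprD opprK mulrN.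
- move=> y; apply: cvgM; last by apply: continuous_normal_pdf; rewrite oner_neq0.
  apply: (cvg_comp (fun y => s * y + x) (fun y => y ^+ 2)).
    by apply: cvgD; [exact: mulrl_continuous|exact: cvg_cst].
  exact: exprn_continuous.
- by move=> y; rewrite mulr_ge0 ?sqr_ge0 ?normal_pdf_ge0.
Qed.

End NormalMoments.

Lemma ae_iff_measure {d : measure_display} {T : measurableType d} {R : realType}
    (mu : {measure set T -> \bar R}) (A B : set T) : measurable A -> measurable B ->
  {ae mu, forall x, A x <-> B x} -> mu A = mu B.
Proof.
move=> mA mB [N [mN N0 AB]].
have le_off_N (C D : set T) : measurable C -> measurable D ->
    (forall x, ~ N x -> C x -> D x) -> (mu C <= mu D)%E.
  move=> mC mD CD; rewrite -[leRHS]adde0 -N0.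
  apply: le_trans (measureU2 _ mD mN); apply: le_measure; rewrite ?inE//.
    exact: measurableU.
  by move=> x Cx; have [Nx|Nx] := pselect (N x); [right|left; exact: CD].
have AB_off_N x : ~ N x -> (A x <-> B x) by move=> Nx; apply: contrapT => /AB.
by apply/eqP; rewrite eq_le !le_off_N// => x /AB_off_N [].
Qed.

Section NormalLaw.
Context {R : realType} {d : measure_display} {Omega : measurableType d}.
Variable P : probability Omega R.
Local Notation mu := (@lebesgue_measure R).
Implicit Types (X : Omega -> R) (m v : R).

Lemma has_normal_law0 X m :
  has_normal_law P X m 0 <-> measurable_fun setT X /\ {ae P, forall w, X w = m}.
Proof.
split=> [[mX lawX]|[mX Xm]].
  split=> //; exists (X @^-1` [set~ m]); split.
  - by rewrite -[A in measurable A]setTI; apply: mX => //; exact: measurableC.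
  - rewrite lawX; last exact: measurableC.
    by rewrite /normal_law eqxx diracE memNset//; apply.
  - by move=> w.
split=> // A mA; rewrite /normal_law eqxx.
have mXA : measurable (X @^-1` A) by rewrite -[B in measurable B]setTI; exact: mX.
rewrite diracE; have [Am|Am] := pselect (A m).
  rewrite (mem_set Am) -(probability_setT P); apply: ae_iff_measure => //.
  by move: Xm; apply: filterS => w /= ->.
transitivity (P set0); last by rewrite measure0 (memNset Am).
apply: ae_iff_measure => //.
by move: Xm; apply: filterS => w /= ->.
Qed.

Lemma normal_law_integral X m v (f : R -> R) : 0 < v -> has_normal_law P X m v ->
  continuous f -> (forall x, 0 <= f x) ->
  (\int[P]_w (f (X w))%:E =
   \int[mu]_x (f (Num.sqrt v * x + m) * normal_pdf 0 1 x)%:E)%E.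
Proof.
move=> v0 [mX lawX] cf f0; have s0 : 0 < Num.sqrt v by rewrite sqrtr_gt0.
have mf : measurable_fun setT (EFin \o f).
  by apply/measurable_EFinP; exact: continuous_measurable_fun.
pose X' : {mfun Omega >-> measurableTypeR R} :=
  HB.pack X (isMeasurableFun.Build _ _ _ (measurableTypeR R) _ mX).
transitivity (\int[distribution P X']_x (f x)%:E)%E.
  by rewrite ge0_integral_distribution//; exact: mf.
transitivity (\int[normal_prob m (Num.sqrt v)]_x (f x)%:E)%E.
  apply: eq_measure_integral => A mA _.
  by rewrite /= /distribution /pushforward /= lawX// /normal_law gt_eqF.
rewrite ge0_integral_normal_prob//; under eq_integral do rewrite -EFinM.
rewrite (ge0_integral_affine m s0).
- by apply: eq_integral => x _; rewrite -mulrA normal_pdf_affine.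
- move=> x; apply: cvgM; first exact: cf.
  by apply: continuous_normal_pdf; rewrite gt_eqF.
- by move=> x; rewrite mulr_ge0 ?normal_pdf_ge0.
Qed.

Lemma normal_law_variance X m v : 0 <= v -> has_normal_law P X m v ->
  X - cst m \in L2 P /\ l2norm P (X - cst m) ^+ 2 = v.
Proof.
move=> v0 nX; have mX : measurable_fun setT X by case: nX.
have mXm : measurable_fun setT (X - cst m) by exact: measurable_funB.
suff int_sqr : (\int[P]_w (((X - cst m) w) ^+ 2)%:E = v%:E)%E.
  have XmL2 : X - cst m \in L2 P by apply/L2P; rewrite int_sqr ltry.
  by split=> //; apply: EFin_inj; rewrite EFin_sqr_l2norm.
move: v0; rewrite le_eqVlt => /predU1P[v0|v0].
  move: nX; rewrite -v0 => /has_normal_law0[_ Xm].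
  rewrite (ae_eq_integral (cst 0%E)) ?integral0//.
    exact/measurable_EFinP/measurable_funX.
  by move: Xm; apply: filterS => w Xw _; rewrite /= fctE Xw subrr expr0n.
rewrite (normal_law_integral (f := fun x => (x - m) ^+ 2) v0 nX); last 2 first.
- move=> x; apply: (cvg_comp (fun y => y - m) (fun y => y ^+ 2)).
    by apply: cvgB; [exact: cvg_id|exact: cvg_cst].
  exact: exprn_continuous.
- by move=> x; exact: sqr_ge0.
under eq_integral do rewrite addrK exprMn sqr_sqrtr ?ltW// -mulrA EFinM.
rewrite ge0_integralZl//; first by rewrite integral_sqr_normal_pdf mule1.
- apply/measurable_EFinP/measurable_funM => //; exact: measurable_normal_pdf.
- by move=> x _; rewrite lee_fin mulr_ge0 ?sqr_ge0 ?normal_pdf_ge0.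
- by rewrite lee_fin ltW.
Qed.

Lemma normal_law_L2 X m v : 0 <= v -> has_normal_law P X m v -> X \in L2 P.
Proof.
move=> v0 /(normal_law_variance v0)[XmL2 _].
by rewrite -(subrK (cst m) X) rpredD ?cst_L2.
Qed.

Lemma normal_law_mean X m v : 0 <= v -> has_normal_law P X m v ->
  \int[P]_w X w = m.
Proof.
move=> v0 nX; have [ZL2 normZ] := normal_law_variance v0 nX.
pose Z := X - cst m; have c1L2 := cst_L2 P 1.
suff Z0 : l2dot P Z (cst 1) = 0.
  have := l2dotDl ZL2 (cst_L2 P m) c1L2.
  by rewrite subrK -/Z Z0 add0r !l2dot_cst1 Rintegral_cst//= probability_setT mulr1.
move: v0; rewrite le_eqVlt => /predU1P[v0|v0].
  apply/eqP; rewrite -normr_le0; apply: le_trans (cauchy_schwarz ZL2 c1L2) _.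
  by move/eqP : normZ; rewrite -v0 sqrf_eq0 => /eqP ->; rewrite mul0r.
have cshift c : continuous (fun x : R => (x - m + c) ^+ 2).
  move=> x; apply: (cvg_comp (fun y => y - m + c) (fun y => y ^+ 2)).
    by apply: cvgD; [apply: cvgB; [exact: cvg_id|]|]; exact: cvg_cst.
  exact: exprn_continuous.
pose I c := (\int[mu]_x ((Num.sqrt v * x + c) ^+ 2 * normal_pdf (0 : R) 1 x)%:E)%E.
have normZD c : ((l2norm P (Z + cst c) ^+ 2)%:E = I c)%E.
  rewrite EFin_sqr_l2norm; last exact: rpredD ZL2 (cst_L2 P c).
  rewrite (normal_law_integral (f := fun x => (x - m + c) ^+ 2) v0 nX)//.
    by apply: eq_integral => x _; rewrite addrK.
  by move=> x; exact: sqr_ge0.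
have normZDB : l2norm P (Z + cst 1) ^+ 2 = l2norm P (Z - cst 1) ^+ 2.
  apply: EFin_inj; rewrite normZD -[Z - _]/(Z + cst (- 1)) normZD /I.
  by rewrite integral_affine_sqr_normal_pdfN.
by have := l2norm_polarization ZL2 c1L2; rewrite normZDB subrr; lra.
Qed.

End NormalLaw.

(** * L2 limits of Gaussian variables *)

Section ConvergenceInLaw.
Context {R : realType} {d : measure_display} {Omega : measurableType d}.
Variable P : probability Omega R.

Lemma eq_probability_ray (mu nu : probability (measurableTypeR R) R) :
  (forall r : R, mu `]r, +oo[%classic = nu `]r, +oo[%classic) ->
  forall A, measurable A -> mu A = nu A.
Proof.
move=> mu_nu A mA.
refine (@measure_unique _ R (measurableTypeR R) (@RGenOInfty.G R)
  (fun k : nat => `](- k%:R), +oo[%classic) _ _ _ _ mu nu _ _ A mA).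
- exact: RGenOInfty.measurableE.
- move=> _ _ [x ->] [y ->]; exists (Num.max x y).
  apply/seteqP; split=> z /=; rewrite !in_itv/= !andbT gt_max.
    by case=> -> ->.
  by move=> /andP[-> ->].
- by move=> i; exists (- i%:R).
- apply/seteqP; split=> // x _; exists (Num.truncn `|x|).+1 => //=.
  rewrite in_itv/= andbT ltrNl; apply: le_lt_trans (truncnS_gt _).
  by rewrite -normrN ler_norm.
- by move=> _ [x ->]; exact: mu_nu.
- by move=> k; rewrite (le_lt_trans (probability_le1 _ _)) ?ltry.
Qed.

Lemma measurable_norm_ge (Z : Omega -> R) (e : R) : measurable_fun setT Z ->
  measurable [set w | e <= `|Z w|].
Proof.
move=> mZ; rewrite -[X in measurable X]setTI.
have : measurable_fun setT (fun w => e <= `|Z w|).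
  by apply: measurable_fun_ler => //; exact: measurableT_comp.
by move=> /(_ measurableT [set true]); apply.
Qed.

Lemma ccdf_le_dist (X Y : {RV P >-> R}) (r e : R) :
  (ccdf X (r + e)%R <= ccdf Y r + P [set w | e <= `|X w - Y w|]%R)%E.
Proof.
have mray (Z : {RV P >-> R}) t : measurable (Z @^-1` `]t, +oo[).
  by rewrite -[B in measurable B]setTI; exact: measurable_funPT.
have mXY : measurable [set w | e <= `|X w - Y w|].
  by apply: measurable_norm_ge; exact: measurable_funB.
apply: le_trans (measureU2 _ (mray Y r) mXY).
rewrite -[leLHS]/(P (X @^-1` `](r + e)%R, +oo[)).
apply: le_measure; rewrite ?inE; [exact: mray|exact: measurableU|].
move=> w; rewrite /= !in_itv/= !andbT => rX.
have [rY|Yr] := ltP r (Y w); [by left|right].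
by apply: le_trans (ler_norm _); lra.
Qed.

Lemma ccdf_le_approx (X Y : {RV P >-> R}) :
  (forall r e, 0 < e -> (ccdf X (r + e)%R <= ccdf Y r + e%:E)%E) ->
  forall r, (ccdf X r <= ccdf Y r)%E.
Proof.
move=> XY r.
have fin (Z : {RV P >-> R}) t : ccdf Z t \is a fin_num by exact: fin_num_measure.
apply/lee_addgt0Pr => e e0; have e2 : 0 < e / 2 by rewrite divr_gt0.
have /fine_cvg : ccdf X t @[t --> r^'+] --> ((fine (ccdf X r))%:E).
  by rewrite fineK//; exact: ccdf_right_continuous.
move=> /cvgrPdist_lt /(_ _ e2) cX.
have [t [Xt rt tr]] : exists t,
    [/\ `|fine (ccdf X r) - fine (ccdf X t)| < e / 2, r < t & t < r + e / 2].
  apply: (@filter_ex _ r^'+); near=> t; split; near: t => //.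
  - exact: nbhs_right_gt.
  - by apply: nbhs_right_lt; rewrite ltrDl.
have := XY r (t - r); rewrite subr_gt0 => /(_ rt); rewrite addrC subrK.
rewrite -(fineK (fin X r)) -(fineK (fin X t)) -(fineK (fin Y r)) -!EFinD !lee_fin.
by move: Xt; rewrite ltr_norml => /andP[_]; lra.
Unshelve. all: end_near. Qed.

Lemma law_closed_in_probability (X Y0 : {RV P >-> R}) :
  (forall e, 0 < e -> exists2 Y : {RV P >-> R},
    (forall A, measurable A -> P (Y @^-1` A) = P (Y0 @^-1` A)) &
    (P [set w | e <= `|Y w - X w|]%R <= e%:E)%E) ->
  forall A, measurable A -> P (X @^-1` A) = P (Y0 @^-1` A).
Proof.
move=> approxX.
pose toR (Z : {RV P >-> R}) : {mfun Omega >-> measurableTypeR R} :=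
  @mfun_Sub _ _ _ (measurableTypeR R) Z (mem_set (measurable_funPT Z)).
suff XY0 r : ccdf X r = ccdf Y0 r.
  exact: (eq_probability_ray (mu := distribution P (toR X))
    (nu := distribution P (toR Y0))).
apply/eqP; rewrite eq_le; apply/andP; split; apply: ccdf_le_approx => {}r e e0.
- have [Y YY0 YX] := approxX _ e0.
  have <- : ccdf Y r = ccdf Y0 r by exact: YY0.
  apply: le_trans (ccdf_le_dist X Y r e) _; apply: leeD2l.
  by under eq_set do rewrite distrC.
- have [Y YY0 YX] := approxX _ e0.
  have <- : ccdf Y (r + e) = ccdf Y0 (r + e) by exact: YY0.
  by apply: le_trans (ccdf_le_dist Y X r e) _; apply: leeD2l.
Qed.

End ConvergenceInLaw.

Section GaussianLimit.
Context {R : realType} {d : measure_display} {Omega : measurableType d}.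
Variable P : probability Omega R.
Implicit Types X Y Z : Omega -> R.

Lemma l2norm_chebyshev Z (e : R) : 0 < e -> Z \in L2 P ->
  (P [set w | e <= `|Z w|]%R <= (l2norm P Z ^+ 2 / e ^+ 2)%:E)%E.
Proof.
move=> e0 ZL2; have mZ := measurable_L2 ZL2.
pose Z' : {RV P >-> R} := mfun_Sub (mem_set mZ).
rewrite EFinM -lee_pdivrMr ?invr_gt0 ?exprn_gt0// invrK muleC.
apply: le_trans (@markov _ _ _ P Z' (fun x => x ^+ 2) e e0 _ _ _) _ => //.
- by move=> r _; exact: sqr_ge0.
- by move=> x y; rewrite !nnegrE => x0 y0; rewrite ler_sqr.
- rewrite EFin_sqr_l2norm// unlock le_eqVlt; apply/orP; left; apply/eqP.
  by apply: eq_integral => w _; rewrite /= real_normK ?num_real.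
Qed.

Lemma normal_law_l2_closed X (m v : R) : 0 <= v -> X \in L2 P ->
  (forall e, 0 < e -> exists2 Y, has_normal_law P Y m v & l2norm P (Y - X) <= e) ->
  has_normal_law P X m v.
Proof.
move=> v0 XL2 approxX.
have toRV Z : Z \in L2 P -> {Z' : {RV P >-> R} | Z' = Z :> (Omega -> R)}.
  by move=> /measurable_L2 mZ; exists (mfun_Sub (mem_set mZ)).
have [[X' X'E] [Y0 nY0 _]] := (toRV _ XL2, approxX _ ltr01).
have [Y0' Y0'E] := toRV _ (normal_law_L2 v0 nY0).
split; first exact: measurable_L2 XL2.
move=> A mA; have [_ <-//] := nY0; rewrite -X'E -Y0'E.
apply: law_closed_in_probability => // e e0.
have [|Y nY YX] := approxX (e * Num.sqrt e); first by rewrite mulr_gt0 ?sqrtr_gt0.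
have YL2 := normal_law_L2 v0 nY; have [Y' Y'E] := toRV _ YL2.
exists Y' => [B mB|].
  by have [[_ lawY] [_ lawY0]] := (nY, nY0); rewrite Y'E Y0'E lawY ?lawY0.
rewrite Y'E X'E; apply: le_trans (l2norm_chebyshev e0 (rpredB YL2 XL2)) _.
rewrite lee_fin ler_pdivrMr ?exprn_gt0//.
have -> : e * e ^+ 2 = (e * Num.sqrt e) ^+ 2.
  by rewrite exprMn sqr_sqrtr ?ltW// mulrC.
by rewrite ler_pXn2r ?nnegrE ?l2norm_ge0// mulr_ge0 ?sqrtr_ge0// ltW.
Qed.

Lemma centred_gaussian_law Y : gaussian_rv P Y -> \int[P]_w Y w = 0 ->
  has_normal_law P Y 0 (l2norm P Y ^+ 2).
Proof.
move=> [m [v [v0 nY]]]; rewrite (normal_law_mean v0 nY) => m0; rewrite m0 in nY.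
by have [_] := normal_law_variance v0 nY; rewrite subr0 => ->.
Qed.

(* The approximating variables are rescaled to have the variance of the limit,
   so that they share one law, which is preserved in the limit. *)
Lemma gaussian_l2_limit (X_ : nat -> Omega -> R) X :
  (forall n, X_ n \in L2 P) -> (forall n, \int[P]_w X_ n w = 0) ->
  (forall n c, gaussian_rv P (c *: X_ n)) -> X \in L2 P -> l2cvg P X_ X ->
  has_normal_law P X 0 (l2norm P X ^+ 2).
Proof.
move=> X_L2 X_0 gX_ XL2 cX.
have [X0|XN0] := eqVneq (l2norm P X) 0.
  rewrite X0 expr0n; apply/has_normal_law0; split; first exact: measurable_L2 XL2.
  exact: l2norm_eq0.
have X0 : 0 < l2norm P X by rewrite lt_def XN0 l2norm_ge0.
apply: normal_law_l2_closed => //; first exact: sqr_ge0.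
move=> e e0; have e2 : 0 < e / 2 by rewrite divr_gt0.
have cXn := l2cvg_norm X_L2 XL2 cX.
have [n [Xn0 normXn distXn]] : exists n, [/\ 0 < l2norm P (X_ n),
    `|l2norm P X - l2norm P (X_ n)| < e / 2 & l2norm P (X_ n - X) < e / 2].
  apply: (@filter_ex _ \oo); near=> n; split; near: n.
  - exact: (cvgr_gt _ cXn).
  - by move/cvgrPdist_lt : cXn; apply.
  - exact: (cvgr_lt _ cX).
pose c := l2norm P X / l2norm P (X_ n).
have cXnL2 : c *: X_ n \in L2 P by rewrite rpredZ.
exists (c *: X_ n).
  have -> : l2norm P X = l2norm P (c *: X_ n).
    by rewrite l2normZ// ger0_norm ?divr_ge0 ?l2norm_ge0// divfK ?gt_eqF.
  apply: centred_gaussian_law => //; rewrite -l2dot_cst1 l2dotZl ?cst_L2//.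
  by rewrite l2dot_cst1 X_0 mulr0.
have -> : c *: X_ n - X = (c - 1) *: X_ n + (X_ n - X).
  by rewrite scalerBl scale1r addrA subrK.
apply: le_trans (ler_l2normD _ _) _; rewrite ?rpredZ ?rpredB//.
rewrite l2normZ// -[X in _ * X]ger0_norm ?l2norm_ge0// -normrM mulrBl mul1r.
by rewrite divfK ?gt_eqF// [leRHS]splitr lerD// ltW.
Unshelve. all: end_near. Qed.

End GaussianLimit.

(** * Independence *)

Section IndependentProduct.
Context {R : realType} {d : measure_display} {Omega : measurableType d}.
Variable P : probability Omega R.

Let pairRV (X Y : {RV P >-> R}) : {RV P >-> (R * R)%type} :=
  mfun_Sub (mem_set (measurable_fun_pair (measurable_funPT X) (measurable_funPT Y))).

Lemma independent_distribution_pair (X Y : {RV P >-> R}) :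
  independent_rv P X Y -> forall A, measurable A ->
  (distribution P X \x distribution P Y)%E A = distribution P (pairRV X Y) A.
Proof.
by move=> XY; apply: product_measure_unique => A B mA mB; rewrite /= -XY.
Qed.

Lemma integrable_distribution (X : {RV P >-> R}) : (X : Omega -> R) \in L2 P ->
  (distribution P X).-integrable setT (fun x => x%:E).
Proof.
move=> /integrable_L2 iX.
have mid : measurable_fun setT (fun x : R => x%:E) by exact/measurable_EFinP.
exact: (integrable_pushforward (measurable_funPT X) mid iX).
Qed.

Lemma integral_distribution_id (X : {RV P >-> R}) : (X : Omega -> R) \in L2 P ->
  (\int[distribution P X]_x x%:E = (\int[P]_w X w)%:E)%E.
Proof.
move=> /integrable_L2 iX; rewrite integral_distribution//.
by rewrite /Rintegral fineK//; exact: (integrable_fin_num measurableT).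
Qed.

Lemma independent_l2dot (X Y : Omega -> R) :
  independent_rv P X Y -> X \in L2 P -> Y \in L2 P ->
  l2dot P X Y = (\int[P]_w X w) * (\int[P]_w Y w).
Proof.
move=> XY XL2 YL2.
pose X' : {RV P >-> R} := mfun_Sub (mem_set (measurable_L2 XL2)).
pose Y' : {RV P >-> R} := mfun_Sub (mem_set (measurable_L2 YL2)).
have prodE := independent_distribution_pair (X := X') (Y := Y') XY.
pose f (z : R * R) := (z.1 * z.2)%:E.
have mf : measurable_fun setT f by apply/measurable_EFinP; exact: measurable_funM.
have ifP : P.-integrable setT (f \o pairRV X' Y') by exact: integrableM_L2.
have ifXY : (distribution P X' \x distribution P Y')%E.-integrable setT f.
  have /integrableP[_] := integrable_pushforward (measurable_funPT (pairRV X' Y'))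
    mf ifP measurableT.
  rewrite -(eq_measure_integral _ (fun A mA _ => prodE A mA)) => fin.
  exact/integrableP.
transitivity (fine (\int[distribution P (pairRV X' Y')]_z f z)%E).
  by rewrite integral_distribution.
rewrite -(eq_measure_integral _ (fun A mA _ => prodE A mA)).
rewrite -integral12_prod_meas1// /fubini_F /f /=.
under eq_integral do
  [under eq_integral do rewrite EFinM; rewrite integralZl ?integrable_distribution//].
by rewrite !integral_distribution_id// integralZr ?integrable_distribution//
  integral_distribution_id.
Qed.

End IndependentProduct.

Section AlmostEverywhereLimit.
Context {d : measure_display} {T : measurableType d} {R : realType}.
Variable mu : {measure set T -> \bar R}.

Lemma nneseries_lty_cvg0 (u : (\bar R)^nat) : (forall n, 0 <= u n)%E ->
  (\sum_(n <oo) u n < +oo)%E -> (u n @[n --> \oo] --> 0)%E.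
Proof.
move=> u0 u_fin.
apply: (@squeeze_cvge _ _ _ _ (cst 0%E) _ (fun N => \sum_(N <= n <oo) u n)%E).
- apply: nearW => n; rewrite u0/=.
  have := @nneseries_lim_ge _ u xpredT n n.+1 (fun k _ _ => u0 k).
  by rewrite big_nat1.
- exact: cvg_cst.
- exact: nneseries_tail_cvg.
Qed.

Lemma l2cvg_ae_subseq (f_ : nat -> T -> R) (g : T -> R) :
  (forall n, f_ n \in L2 mu) -> g \in L2 mu -> l2cvg mu f_ g ->
  exists k : nat -> nat, {ae mu, forall x, f_ (k j) x @[j --> \oo] --> g x}.
Proof.
move=> f_L2 gL2 cf; have dL2 n : f_ n - g \in L2 mu by rewrite rpredB.
have cf2 : l2norm mu (f_ n - g) ^+ 2 @[n --> \oo] --> 0.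
  by under eq_cvg do rewrite expr2; have := cvgM cf cf; rewrite mulr0; apply.
have /choice[k distk] : forall j, exists n,
    l2norm mu (f_ n - g) ^+ 2 < 1 / (2 ^ (j + 1))%:R.
  move=> j; have e0 : 0 < 1 / (2 ^ (j + 1))%:R :> R.
    by rewrite divr_gt0// ltr0n expn_gt0.
  by have [n _ /(_ n (leqnn n)) distn] := cvgr_lt _ cf2 _ e0; exists n.
exists k; pose h j x := ((((f_ (k j) - g) x) ^+ 2)%:E : \bar R).
have h0 j x : (0 <= h j x)%E by rewrite lee_fin sqr_ge0.
have mh j : measurable_fun setT (h j).
  by apply/measurable_EFinP/measurable_funX; exact: measurable_L2.
have ih : mu.-integrable setT (fun x => \sum_(j <oo) h j x)%E.
  apply/integrableP; split; first exact: ge0_emeasurable_sum.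
  under eq_integral do rewrite gee0_abs ?nneseries_ge0//.
  rewrite integral_nneseries//.
  apply: (@le_lt_trans _ _ (\sum_(j <oo) (1 / (2 ^ (j + 1))%:R : R)%:E)%E).
    apply: lee_nneseries => [j _ _|j _]; first exact: integral_ge0.
    by rewrite /h -EFin_sqr_l2norm// lee_fin ltW.
  have /cvg_lim -> // := @cvg_geometric_eseries_half R 1 0.
  exact: ltry.
have := integrable_ae measurableT ih; apply: filterS => x /(_ I) finx.
have hx0 : (h j x @[j --> \oo] --> 0)%E.
  by apply: nneseries_lty_cvg0 => //; rewrite -ge0_fin_numE//; exact: nneseries_ge0.
have : ((f_ (k j) - g) x) ^+ 2 @[j --> \oo] --> 0 by exact: fine_cvg hx0.
move=> /cvgrPdist_lt cfx; apply/cvgrPdist_lt => e e0.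
have := cfx _ (exprn_gt0 2 e0); apply: filterS => j.
rewrite sub0r normrN /= normrX ltr_pXn2r ?nnegrE//; last exact: ltW.
by rewrite distrC.
Qed.

Lemma l2cvg_ae_measurable (G : set (set T)) (f_ : nat -> T -> R) (g : T -> R) :
  (forall n, @measurable_fun _ _ (g_sigma_algebraType G) R setT (f_ n)) ->
  (forall n, f_ n \in L2 mu) -> g \in L2 mu -> l2cvg mu f_ g ->
  exists2 f : T -> R, @measurable_fun _ _ (g_sigma_algebraType G) R setT f &
    {ae mu, forall x, g x = f x}.
Proof.
move=> mf f_L2 gL2 cf; have [k fk] := l2cvg_ae_subseq f_L2 gL2 cf.
exists (fun x => fine (limn_esup (fun j => (f_ (k j) x)%:E))).
  apply: measurableT_comp => //.
  apply: (@measurable_fun_limn_esup _ (g_sigma_algebraType G) R setT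
    (fun j x => (f_ (k j) x)%:E)) => j.
  exact/measurable_EFinP.
move: fk; apply: filterS => x fkx.
have fkxE : (f_ (k j) x)%:E @[j --> \oo] --> (g x)%:E.
  by apply: cvg_EFin => //; exact: nearW.
by rewrite limn_esup_lim; have /cvg_lim -> := cvg_esups fkxE.
Qed.

End AlmostEverywhereLimit.

Section IndependentSigmaAlgebras.
Context {R : realType} {d : measure_display} {Omega : measurableType d}.
Variable P : probability Omega R.
Implicit Types (G H : set (set Omega)) (A B : set Omega).

Definition independent_classes G H :=
  forall A B, G A -> H B -> (P (A `&` B) = P A * P B)%E.

Lemma independent_classesC G H : independent_classes G H -> independent_classes H G.
Proof. by move=> GH A B HA GB; rewrite setIC muleC GH. Qed.

Lemma independent_g_sigma_algebra_l G H : setI_closed G -> G setT ->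
  G `<=` measurable -> H `<=` measurable ->
  independent_classes G H -> independent_classes <<s G >> H.
Proof.
move=> GI GT Gm Hm GH A B sA HB; have mB := Hm _ HB.
have PB0 : 0 <= fine (P B) by exact: fine_ge0.
have scaleE C : mscale (NngNum PB0) P C = (P C * P B)%E.
  by rewrite /mscale /= fineK ?fin_num_measure// muleC.
rewrite -scaleE; apply: (@g_sigma_algebra_measure_unique _ R Omega G Gm
  (fun=> setT) (fun=> GT) _ (mrestr P mB) (mscale (NngNum PB0) P) GI) => //.
- by rewrite bigcup_const//; exists 0%N.
- by move=> C GC; rewrite [RHS]scaleE -GH.
- by move=> _; apply: le_lt_trans (ltry 1); apply: probability_le1; exact: measurableI.
Qed.

Lemma sub_g_sigma_algebra_measurable G : G `<=` measurable ->
  <<s G >> `<=` (measurable : set (set Omega)).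
Proof. exact: smallest_sub (@sigma_algebra_measurable _ Omega). Qed.

Lemma independent_g_sigma_algebras G H : setI_closed G -> setI_closed H ->
  G setT -> H setT -> G `<=` measurable -> H `<=` measurable ->
  independent_classes G H -> independent_classes <<s G >> <<s H >>.
Proof.
move=> GI HI GT HT Gm Hm GH; have sHm := sub_g_sigma_algebra_measurable Hm.
apply: independent_g_sigma_algebra_l => //.
by apply/independent_classesC/independent_g_sigma_algebra_l => //;
  exact: independent_classesC.
Qed.

Section Families.
Context {I : eqType} (D : set I) (X : I -> Omega -> R[i]).
Hypothesis mX : forall i, D i -> measurable_fun setT (fun w => cpair (X i w)).
Hypothesis iX : mutually_independent P D X.

Definition family_events (J : set I) : set (set Omega) :=
  [set A | exists i (B : set (R * R)),
    [/\ J i, measurable B & A = [set w | B (cpair (X i w))]]].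

Definition cylinder (s : seq I) (B : I -> set (R * R)) : set Omega :=
  [set w | forall i, i \in s -> B i (cpair (X i w))].

Definition cylinders (J : set I) : set (set Omega) :=
  [set A | exists (s : seq I) (B : I -> set (R * R)),
    [/\ uniq s, forall i, i \in s -> J i, forall i, measurable (B i) &
        A = cylinder s B]].

Lemma family_events_cylinders (J : set I) : family_events J `<=` cylinders J.
Proof.
move=> _ [i [B [Ji mB ->]]]; exists [:: i], (fun=> B); split=> //.
  by move=> j; rewrite inE => /eqP ->.
apply/seteqP; split=> w /=; last by apply; rewrite inE.
by move=> Bw j; rewrite inE => /eqP ->.
Qed.

Lemma cylindersT (J : set I) : cylinders J setT.
Proof. by exists [::], (fun=> setT); split=> //; apply/seteqP; split. Qed.

Lemma cylindersI (J : set I) : setI_closed (cylinders J).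
Proof.
move=> _ _ [s [B [us sJ mB ->]]] [t [C [ut tJ mC ->]]].
exists (undup (s ++ t)), (fun i => (if i \in s then B i else setT) `&`
  (if i \in t then C i else setT)); split.
- exact: undup_uniq.
- by move=> i; rewrite mem_undup mem_cat => /orP[/sJ|/tJ].
- by move=> i; apply: measurableI; case: ifP.
- apply/seteqP; split=> w /=.
    move=> [sB tC] i; rewrite mem_undup mem_cat => _.
    by split; case: ifPn => //; [exact: sB|exact: tC].
  move=> BC; split=> i; [move=> i_s|move=> i_t]; have := BC i.
    by rewrite mem_undup mem_cat i_s => /(_ isT)[].
  by rewrite mem_undup mem_cat i_t orbT => /(_ isT)[].
Qed.

Lemma cylinders_measurable (J : set I) : J `<=` D -> cylinders J `<=` measurable.
Proof.
move=> JD _ [s [B [_ sJ mB ->]]]; elim: s sJ => [_|i s IH sJ].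
  by rewrite (_ : cylinder _ _ = setT)//; apply/seteqP; split.
have -> : cylinder (i :: s) B =
    (fun w => cpair (X i w)) @^-1` (B i) `&` cylinder s B.
  apply/seteqP; split=> w /=.
    by move=> Bw; split=> [|j js]; apply: Bw; rewrite ?mem_head// in_cons js orbT.
  by move=> [Biw Bsw] j; rewrite in_cons => /predU1P[->|/Bsw].
apply: measurableI.
  rewrite -[S in measurable S]setTI; apply: mX => //.
  by apply/JD/sJ; rewrite mem_head.
by apply: IH => j js; apply: sJ; rewrite in_cons js orbT.
Qed.

Lemma independent_cylinders (J K : set I) : J `<=` D -> K `<=` D ->
  J `&` K = set0 -> independent_classes (cylinders J) (cylinders K).
Proof.
move=> JD KD JK _ _ [s [B [us sJ mB ->]]] [t [C [ut tK mC ->]]].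
have t_notin_s i : i \in t -> i \notin s.
  move=> it; apply/negP => i_s.
  by have : (J `&` K) i by [split; [exact: sJ|exact: tK]]; rewrite JK.
pose BC i := if i \in s then B i else C i.
have BCs i : i \in s -> BC i = B i by rewrite /BC => ->.
have BCt i : i \in t -> BC i = C i by rewrite /BC => /t_notin_s/negbTE ->.
have -> : cylinder s B `&` cylinder t C = cylinder (s ++ t) BC.
  apply/seteqP; split=> w /=.
    move=> [Bw Cw] i; rewrite mem_cat => /orP[i_s|i_t].
      by rewrite BCs//; exact: Bw.
    by rewrite BCt//; exact: Cw.
  move=> BCw; split=> i i_st; have := BCw i; rewrite mem_cat i_st ?orbT => /(_ isT).
    by rewrite BCs.
  by rewrite BCt.
have ust : uniq (s ++ t) by rewrite cat_uniq us ut andbT; exact/hasPn.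
rewrite (iX ust) => [|i|i]; last 2 first.
- by rewrite mem_cat => /orP[/sJ/JD|/tK/KD].
- by rewrite /BC; case: ifP.
rewrite (iX us) => [|i /sJ/JD//|//]; rewrite (iX ut) => [|i /tK/KD//|//].
rewrite big_cat; congr (_ * _)%E; apply: eq_big_seq => i i_st; first by rewrite BCs.
by rewrite BCt.
Qed.

Lemma independent_family_events (J K : set I) : J `<=` D -> K `<=` D ->
  J `&` K = set0 ->
  independent_classes <<s family_events J >> <<s family_events K >>.
Proof.
move=> JD KD JK A B sA sB.
apply: (independent_g_sigma_algebras (@cylindersI J) (@cylindersI K)
  (@cylindersT J) (@cylindersT K) (cylinders_measurable JD)
  (cylinders_measurable KD) (independent_cylinders JD KD JK)).
- exact: sub_sigma_algebra2 (@family_events_cylinders J) _ sA.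
- exact: sub_sigma_algebra2 (@family_events_cylinders K) _ sB.
Qed.

End Families.

Definition ae_in_sigma G A :=
  measurable A /\ exists2 A', <<s G >> A' & {ae P, forall w, A w <-> A' w}.

Lemma sub_ae_in_sigma G H :
  G `<=` ae_in_sigma H -> <<s G >> `<=` ae_in_sigma H.
Proof.
move=> GH; apply: smallest_sub => //; split.
- by split=> //; exists set0; [exact: sigma_algebra0|exact: aeW].
- move=> A [mA [A' sA' AA']]; split; first exact: measurableD.
  exists (~` A'); first exact: sigma_algebraC.
  move: AA'; apply: filterS => w [AA' A'A]; rewrite setTD /setC /=.
  by split=> nA ?; apply: nA; [exact: A'A|exact: AA'].
- move=> A sA; split; first by apply: bigcupT_measurable => n; have [] := sA n.
  have /choice[A' A'P] : forall n, exists A', <<s H >> A' /\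
      {ae P, forall w, A n w <-> A' w}.
    by move=> n; have [_ [A' ? ?]] := sA n; exists A'.
  exists (\bigcup_n A' n).
    by apply: sigma_algebra_bigcup => n; have [] := A'P n.
  have : {ae P, forall w, forall n, A n w <-> A' n w}.
    by apply: ae_foralln => n; have [] := A'P n.
  by apply: filterS => w AA'w; split=> -[n _ An]; exists n => //; exact/AA'w.
Qed.

Lemma independent_ae_in_sigma G H : G `<=` measurable -> H `<=` measurable ->
  independent_classes <<s G >> <<s H >> ->
  independent_classes (ae_in_sigma G) (ae_in_sigma H).
Proof.
move=> Gm Hm GH A B [mA [A' sA' AA']] [mB [B' sB' BB']].
have mA' := sub_g_sigma_algebra_measurable Gm sA'.
have mB' := sub_g_sigma_algebra_measurable Hm sB'.
rewrite (ae_iff_measure mA mA' AA') (ae_iff_measure mB mB' BB') -GH//.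
apply: ae_iff_measure; [exact: measurableI..|].
move: BB'; apply: filterS2 AA' => w [AA' A'A] [BB' B'B].
by split=> -[hA hB]; split; [exact: AA'|exact: BB'|exact: A'A|exact: B'B].
Qed.

Lemma field_events_ae_in_sigma (dS : measure_display) (S : measurableType dS)
    (E : set S) (X : S -> Omega -> R[i]) G :
  (forall x, E x -> measurable_fun setT (fun w => cpair (X x w))) ->
  (forall x, E x -> exists2 f : Omega -> R * R,
    @measurable_fun _ _ (g_sigma_algebraType G) _ setT f &
    {ae P, forall w, cpair (X x w) = f w}) ->
  field_events E X `<=` ae_in_sigma G.
Proof.
move=> mX aeX; apply: sub_ae_in_sigma => _ [x [B [Ex mB ->]]]; split.
  by rewrite -[U in measurable U]setTI; exact: mX.
have [f mf Xf] := aeX x Ex; exists (f @^-1` B).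
  by have := mf measurableT B mB; rewrite setTI.
by move: Xf; apply: filterS => w /= ->.
Qed.

End IndependentSigmaAlgebras.

(** * Fourier coefficients on the circle *)

Section AverageBound.
Context {d1 d2 : measure_display} {S : measurableType d1} {Omega : measurableType d2}.
Context {R : realType}.

Lemma measurable_Rintegral_param (nu : {sigma_finite_measure set S -> \bar R})
    (f : S * Omega -> R) :
  measurable_fun setT f -> measurable_fun setT (fun w => \int[nu]_x f (x, w)).
Proof.
move=> mf; apply: measurableT_comp; first exact: fine_measurable.
have mfE : measurable_fun setT (EFin \o f) by exact/measurable_EFinP.
under eq_fun do rewrite integralE.
apply: emeasurable_funB.
- have := @measurable_fun_fubini_tonelli_G _ _ _ _ _ nu
    (EFin \o f)^\+%E (measurable_funepos mfE) (fun x => funepos_ge0 _ x).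
  rewrite /fubini_G; congr measurable_fun; apply/funext => w.
  by apply: eq_integral => x _; rewrite !funeposE.
- have := @measurable_fun_fubini_tonelli_G _ _ _ _ _ nu
    (EFin \o f)^\-%E (measurable_funeneg mfE) (fun x => funeneg_ge0 _ x).
  rewrite /fubini_G; congr measurable_fun; apply/funext => w.
  by apply: eq_integral => x _; rewrite !funenegE.
Qed.

Variables (nu : probability S R) (P : probability Omega R).

Variables (u : S -> Omega -> R) (K : R).
Hypothesis measurable_u : measurable_fun setT (fun p : S * Omega => u p.1 p.2).
Hypothesis uK : {ae nu, forall x, (\int[P]_w (u x w ^+ 2)%:E <= (K ^+ 2)%:E)%E}.

Let measurable_u2 : measurable_fun setT (fun p : S * Omega => (u p.1 p.2 ^+ 2)%:E).
Proof. by apply/measurable_EFinP; exact: measurable_funX. Qed.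

Let u2_ge0 (p : S * Omega) : (0 <= (u p.1 p.2 ^+ 2)%:E)%E.
Proof. by rewrite lee_fin sqr_ge0. Qed.

Let sqmean w := (\int[nu]_x (u x w ^+ 2)%:E)%E.

Let sqmean_ge0 w : (0 <= sqmean w)%E.
Proof. by apply: integral_ge0 => x _; exact: (u2_ge0 (x, w)). Qed.

Let measurable_sqmean : measurable_fun setT sqmean.
Proof. exact: (@measurable_fun_fubini_tonelli_G _ _ _ _ _ nu _ measurable_u2 u2_ge0). Qed.

Let integral_sqmean_le : (\int[P]_w sqmean w <= (K ^+ 2)%:E)%E.
Proof.
rewrite -(@fubini_tonelli _ _ _ _ _ nu P (fun p => (u p.1 p.2 ^+ 2)%:E))//.
have -> : ((K ^+ 2)%:E = \int[nu]_x (K ^+ 2)%:E)%E.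
  by rewrite integral_cst//= probability_setT mule1.
apply: ae_ge0_le_integral => //.
- by move=> x _; apply: integral_ge0 => w _; exact: (u2_ge0 (x, w)).
- exact: (@measurable_fun_fubini_tonelli_F _ _ _ _ _ P _ measurable_u2 u2_ge0).
- by move=> x _; rewrite lee_fin sqr_ge0.
- by move: uK; apply: filterS => x + _.
Qed.

Lemma ae_section_L2 : {ae P, forall w, u ^~ w \in L2 nu}.
Proof.
have int_sqmean : P.-integrable setT sqmean.
  apply/integrableP; split=> //; apply: le_lt_trans _ (ltry (K ^+ 2)).
  by under eq_integral do rewrite gee0_abs//.
have := integrable_ae measurableT int_sqmean; apply: filterS => w /(_ I).
rewrite ge0_fin_numE// => sqmean_fin; apply/L2P; split=> //.
exact: (measurableT_comp measurable_u (pair2_measurable w)).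
Qed.

Lemma l2norm_average_le : 0 <= K ->
  (fun w => \int[nu]_x u x w) \in L2 P /\
  l2norm P (fun w => \int[nu]_x u x w) <= K.
Proof.
move=> K0; have m_avg : measurable_fun setT (fun w => \int[nu]_x u x w).
  exact: (@measurable_Rintegral_param nu (fun p => u p.1 p.2)).
apply: l2norm_le => //; apply: le_trans integral_sqmean_le.
apply: ae_ge0_le_integral => //.
- by move=> w _; rewrite lee_fin sqr_ge0.
- by apply/measurable_EFinP; exact: measurable_funX.
- move: ae_section_L2; apply: filterS => w uwL2 _.
  by rewrite /sqmean -(EFin_sqr_l2norm uwL2) lee_fin; exact: sqr_Rintegral_le.
Qed.

End AverageBound.

Section Waves.
Context {R : realType}.
Implicit Types (x : R) (b : bool) (k m : nat).

Definition cproj b (p : R * R) : R := if b then p.2 else p.1.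

Definition cpart b (z : R[i]) : R := cproj b (cpair z).

Lemma measurable_cproj b : measurable_fun setT (cproj b).
Proof. by case: b; [exact: measurable_snd|exact: measurable_fst]. Qed.

Definition wave b m x : R := cpart b (expi (- (m%:R * x))).

Definition wave_sqmean b m : R := if m == 0%N then (~~ b)%:R else 2^-1.

Lemma waveE b m x : wave b m x = if b then - sin (m%:R * x) else cos (m%:R * x).
Proof. by case: b; rewrite /wave /cpart /cproj /expi /= ?sinN ?cosN. Qed.

Lemma wave_le1 b m x : `|wave b m x| <= 1.
Proof.
rewrite waveE; case: b; first by rewrite normrN ler_norml sin_geN1 sin_le1.
by rewrite ler_norml cos_geN1 cos_le1.
Qed.

Lemma continuous_cosM (c : R) : continuous (fun x => cos (c * x)).
Proof.
move=> x; apply: continuous_comp; last exact: continuous_cos.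
exact: mulrl_continuous.
Qed.

Lemma continuous_sinM (c : R) : continuous (fun x => sin (c * x)).
Proof.
move=> x; apply: continuous_comp; last exact: continuous_sin.
exact: mulrl_continuous.
Qed.

Lemma continuous_wave b m : continuous (wave b m).
Proof.
rewrite (funext (waveE b m)); case: b; last exact: continuous_cosM.
by move=> x; apply: cvgN; exact: continuous_sinM.
Qed.

Lemma wave_product b b' k m x : (m <= k)%N ->
  wave b k x * wave b' m x = 2^-1 *
  (if b == b' then cos ((k - m)%:R * x) + (-1) ^+ b * cos ((k + m)%:R * x)
   else (-1) ^+ b * sin ((k - m)%:R * x) - sin ((k + m)%:R * x)).
Proof.
move=> mk; rewrite !waveE natrB// natrD mulrBl mulrDl.
by case: b b' => -[]; rewrite /= ?cosB ?cosD ?sinB ?sinD; field.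
Qed.

End Waves.

Lemma continuous_sum {R : realType} (I : Type) (r : seq I) (F : I -> R -> R) :
  (forall i, continuous (F i)) -> continuous (fun x => \sum_(i <- r) F i x).
Proof.
by move=> cF x; apply: cvg_big => [|i _]; [exact: add_continuous|exact: cF].
Qed.

Section ExactMeans.
Context {R : realType}.

Definition trig_exact (N : nat) (mean : (R -> R) -> R) : Prop :=
  [/\ forall f g : R -> R, continuous f -> continuous g ->
        mean (f \+ g) = mean f + mean g,
      forall (c : R) (f : R -> R), continuous f -> mean (c \*: f) = c * mean f,
      forall j, (j < N)%N -> mean (fun x => cos (j%:R * x)) = (j == 0%N)%:R &
      forall j, (j < N)%N -> mean (fun x => sin (j%:R * x)) = 0].

Variables (N : nat) (mean : (R -> R) -> R).
Hypothesis exact_mean : trig_exact N mean.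

Let continuousZ (c : R) (f : R -> R) : continuous f -> continuous (c \*: f).
Proof. by move=> cf x; apply: cvgM; [exact: cvg_cst|exact: cf]. Qed.

Let continuousD (f g : R -> R) : continuous f -> continuous g -> continuous (f \+ g).
Proof. by move=> cf cg x; apply: cvgD; [exact: cf|exact: cg]. Qed.

Lemma mean_waveM b b' k m : (k + m < N)%N ->
  mean (fun x => wave b k x * wave b' m x) =
  ((b == b') && (k == m))%:R * wave_sqmean b m.
Proof.
have [meanD meanZ mean_cos mean_sin] := exact_mean.
wlog mk : b b' k m / (m <= k)%N => [wl|].
  have [mk|/ltnW km kmN] := leqP m k; first exact: wl.
  rewrite [b == b']eq_sym [k == m]eq_sym; under eq_fun do rewrite mulrC.
  rewrite wl//; last by rewrite addnC.
  by case: eqP => [->|_]; rewrite ?mul0r//; case: eqP => [->|_]; rewrite ?mul0r.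
move=> kmN; have kBmN : (k - m < N)%N by lia.
under eq_fun do rewrite wave_product//.
have [->|bb'] := eqVneq b b'; last first.
  pose sinw j x : R := sin (j%:R * x).
  have csin j : continuous (sinw j) by exact: continuous_sinM.
  transitivity (mean (2^-1 \*: ((-1) ^+ b \*: sinw (k - m)%N \+ -1 \*: sinw (k + m)%N))).
    by congr mean; apply/funext => x; rewrite /= scaleN1r.
  have csinZ c j : continuous (c \*: sinw j) := continuousZ (csin j).
  rewrite meanZ; last exact: continuousD.
  by rewrite meanD// !meanZ// !mean_sin// !mulr0 addr0 mulr0 mul0r.
pose cosw j x : R := cos (j%:R * x).
have ccos j : continuous (cosw j) by exact: continuous_cosM.
transitivity (mean (2^-1 \*: (cosw (k - m)%N \+ (-1) ^+ b' \*: cosw (k + m)%N))) => //.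
have ccosZ c j : continuous (c \*: cosw j) := continuousZ (ccos j).
rewrite meanZ; last exact: continuousD.
rewrite meanD// meanZ// !mean_cos// subn_eq0 addn_eq0 /wave_sqmean.
have [->|km] := eqVneq k m; last first.
  have /negbTE -> : ~~ ((k == 0%N) && (m == 0%N)) by lia.
  by rewrite leqNgt ltn_neqAle eq_sym km mk mulr0 addr0 mulr0 mul0r.
by rewrite leqnn; case: eqP => _; case: (b') => /=; lra.
Qed.

Lemma mean_sum (I : Type) (r : seq I) (F : I -> R -> R) :
  (forall i, continuous (F i)) ->
  mean (fun x => \sum_(i <- r) F i x) = \sum_(i <- r) mean (F i).
Proof.
have [meanD meanZ _ _] := exact_mean.
move=> cF; elim: r => [|i r IH].
  rewrite big_nil; transitivity (mean (0 \*: (fun=> 0))).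
    by congr mean; apply/funext => x; rewrite big_nil /= scaler0.
  by rewrite meanZ ?mul0r// => x; exact: cvg_cst.
under eq_fun do rewrite big_cons.
by rewrite big_cons -IH -meanD//; exact: continuous_sum.
Qed.

End ExactMeans.

Section CircleMean.
Context {R : realType}.
Local Notation mu := (@lebesgue_measure R).

Definition circle_mean (f : R -> R) : R :=
  (2 * pi)^-1 * \int[mu]_(x in `[0, 2 * pi]) f x.

Let pi2_gt0 : 0 < 2 * pi :> R. Proof. by rewrite mulr_gt0 ?pi_gt0. Qed.

Definition circle_prob : probability (measurableTypeR R) R := uniform_prob pi2_gt0.

Lemma circle_meanE (f : R -> R) : measurable_fun setT f ->
  circle_mean f = \int[circle_prob]_x f x.
Proof.
move=> mf; have mfE : measurable_fun setT (EFin \o f) by exact/measurable_EFinP.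
have c0 : 0 < (2 * pi)^-1 :> R by rewrite invr_gt0.
rewrite /circle_mean /Rintegral /circle_prob integralE [in RHS]integralE.
rewrite !integral_uniform//; [|exact: measurable_funeneg|exact: measurable_funepos].
rewrite subr0; move: (integral mu _ _) (integral mu _ _) => p q.
case: p q => [p| |] [q| |]; rewrite //= ?mulrBr ?mulr0//.
all: by rewrite !(gt0_muley, gt0_muleNy, mulry, mulrNy, gtr0_sg)//= ?mul1e ?mulr0.
Qed.

Lemma ae_circle_prob (A : R -> Prop) : (forall x, 0 <= x < 2 * pi -> A x) ->
  {ae circle_prob, forall x : R, A x}.
Proof.
move=> circleA; have circle1 : circle_prob `[0, 2 * pi[%classic = 1%E.
  rewrite /circle_prob /= /uniform_prob integral_itv_bndo_bndc.
    exact: integral_uniform_pdf1.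
  by apply/measurable_EFinP/measurable_funTS; exact: measurable_uniform_pdf.
exists (~` `[0, 2 * pi[%classic); split.
- by apply: measurableC; exact: measurable_itv.
- by rewrite probability_setC ?circle1 ?subee//; exact: measurable_itv.
- by move=> x /= nAx; rewrite in_itv => /= /circleA.
Qed.

Let integrable_circle (h : R -> R) : continuous h ->
  mu.-integrable `[0, 2 * pi] (EFin \o h).
Proof.
move=> ch; apply: continuous_compact_integrable; first exact: segment_compact.
exact: continuous_subspaceT.
Qed.

Lemma continuous_L2_circle (h : R -> R) : continuous h -> h \in L2 circle_prob.
Proof.
move=> ch; have mh : measurable_fun setT h by exact: continuous_measurable_fun.
have ch2 : continuous (fun x => h x ^+ 2).
  by move=> x; apply: (cvg_comp h (fun y => y ^+ 2) (ch x)); exact: exprn_continuous.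
apply/L2P; split=> //; rewrite /circle_prob integral_uniform//; last 2 first.
- by apply/measurable_EFinP; exact: measurable_funX.
- by move=> x; rewrite lee_fin sqr_ge0.
have /integrableP[_] := integrable_circle ch2.
under eq_integral do rewrite /= ger0_norm ?sqr_ge0//; move=> fin.
by rewrite lte_mul_pinfty ?lee_fin ?invr_ge0 ?subr0 ?ltW.
Qed.

Let circle_mean_FTC (f F : R -> R) : continuous f ->
  (forall x : R, is_derive x (1 : R) F (f x)) ->
  circle_mean f = (2 * pi)^-1 * (F (2 * pi) - F 0).
Proof.
move=> cf dF; congr (_ * _); rewrite /Rintegral.
have cF x : {for x, continuous F}.
  apply: differentiable_continuous; apply/derivable1_diffP.
  exact: (@ex_derive _ _ _ _ _ _ _ (dF x)).
rewrite (@continuous_FTC2 _ f F)//.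
- exact: continuous_subspaceT.
- split.
  + by move=> x _; exact: (@ex_derive _ _ _ _ _ _ _ (dF x)).
  + exact/cvg_at_right_filter/cF.
  + exact/cvg_at_left_filter/cF.
- by move=> x _; rewrite derive1E; exact: (@derive_val _ _ _ _ _ _ _ (dF x)).
Qed.

Lemma sin_2pi_nat (j : nat) : sin (j%:R * (2 * pi)) = 0 :> R.
Proof. by rewrite !mulr_natl -[_ *+ j]add0r (periodicn (@sinD2pi R)) sin0. Qed.

Lemma cos_2pi_nat (j : nat) : cos (j%:R * (2 * pi)) = 1 :> R.
Proof. by rewrite !mulr_natl -[_ *+ j]add0r (periodicn (@cosD2pi R)) cos0. Qed.

Lemma circle_mean_cos (j : nat) :
  circle_mean (fun x => cos (j%:R * x)) = (j == 0%N)%:R.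
Proof.
case: j => [|j].
  rewrite (_ : circle_mean _ = (2 * pi)^-1 * (2 * pi - 0)).
    by rewrite /= subr0 mulVf// gt_eqF.
  apply: (@circle_mean_FTC _ idfun); first exact: continuous_cosM.
  by move=> x; rewrite mul0r cos0; exact: is_derive_id.
have j0 : (j.+1%:R : R) != 0 by rewrite pnatr_eq0.
pose F (x : R) := j.+1%:R^-1 * sin (j.+1%:R * x).
rewrite (_ : circle_mean _ = (2 * pi)^-1 * (F (2 * pi) - F 0)).
  by rewrite /F sin_2pi_nat !mulr0 sin0 mulr0 subrr mulr0.
apply: circle_mean_FTC; first exact: continuous_cosM.
rewrite /F; move: (j.+1%:R : R) j0 => c c0 x; apply: is_derive_eq.
by rewrite /GRing.scale /= mulr1; field.
Qed.

Lemma circle_mean_sin (j : nat) : circle_mean (fun x => sin (j%:R * x)) = 0.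
Proof.
case: j => [|j].
  rewrite (_ : circle_mean _ = (2 * pi)^-1 * (0 - 0)); first by rewrite subrr mulr0.
  apply: (@circle_mean_FTC _ (cst 0)); first exact: continuous_sinM.
  by move=> x; rewrite mul0r sin0; exact: is_derive_cst.
have j0 : (j.+1%:R : R) != 0 by rewrite pnatr_eq0.
pose F (x : R) := - (j.+1%:R^-1 * cos (j.+1%:R * x)).
rewrite (_ : circle_mean _ = (2 * pi)^-1 * (F (2 * pi) - F 0)).
  by rewrite /F cos_2pi_nat mulr0 cos0 subrr mulr0.
apply: circle_mean_FTC; first exact: continuous_sinM.
rewrite /F; move: (j.+1%:R : R) j0 => c c0 x; apply: is_derive_eq.
by rewrite /GRing.scale /= mulr1; field.
Qed.

Lemma circle_mean_exact N : trig_exact N circle_mean.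
Proof.
split=> [f g cf cg|c f cf|j _|j _].
- by rewrite /circle_mean -mulrDr RintegralD//; exact: integrable_circle.
- rewrite /circle_mean mulrCA; congr (_ * _).
  by apply: RintegralZl => //; exact: integrable_circle.
- exact: circle_mean_cos.
- exact: circle_mean_sin.
Qed.

End CircleMean.

Section SampleMean.
Context {R : realType}.
Variable N : nat.

Definition sample_point (k : nat) : R := 2 * pi * k%:R / N%:R.

Definition sample_mean (f : R -> R) : R := N%:R^-1 * \sum_(k < N) f (sample_point k).

Lemma sample_point_itv (k : nat) : (k < N)%N -> 0 <= sample_point k < 2 * pi.
Proof.
move=> kN; have N0 : (0 : R) < N%:R by rewrite ltr0n (leq_ltn_trans _ kN).
have pi2 : 0 < 2 * pi :> R by rewrite mulr_gt0 ?pi_gt0.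
rewrite /sample_point -mulrA mulr_ge0 ?divr_ge0 ?(ltW pi2)//=.
by rewrite gtr_pMr// ltr_pdivrMr// mul1r ltr_nat.
Qed.

Let sum_cos (a : R) (n : nat) : (\sum_(k < n) cos (k%:R * a)) * (2 * sin (a / 2)) =
  sin (n%:R * a - a / 2) + sin (a / 2).
Proof.
elim: n => [|n IH]; first by rewrite big_ord0 !mul0r sub0r sinN addNr.
rewrite big_ord_recr/= mulrDl IH -[n.+1%:R]natr1.
have -> : (n%:R + 1) * a - a / 2 = n%:R * a + a / 2 by field.
by rewrite sinB sinD; ring.
Qed.

Let sum_sin (a : R) (n : nat) : (\sum_(k < n) sin (k%:R * a)) * (2 * sin (a / 2)) =
  cos (a / 2) - cos (n%:R * a - a / 2).
Proof.
elim: n => [|n IH]; first by rewrite big_ord0 !mul0r sub0r cosN subrr.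
rewrite big_ord_recr/= mulrDl IH -[n.+1%:R]natr1.
have -> : (n%:R + 1) * a - a / 2 = n%:R * a + a / 2 by field.
by rewrite cosB cosD; ring.
Qed.

Let angleE (j k : nat) :
  j%:R * sample_point k = k%:R * (j%:R * (2 * pi) / N%:R) :> R.
Proof. by rewrite /sample_point; ring. Qed.

Let sin_half_neq0 (j : nat) : (0 < j < N)%N ->
  2 * sin (j%:R * (2 * pi) / N%:R / 2) != 0 :> R.
Proof.
move=> /andP[j0 jN]; rewrite mulf_neq0 ?pnatr_eq0// gt_eqF// sin_gt0_pi//.
have N0 : (0 : R) < N%:R by rewrite ltr0n (ltn_trans j0).
have -> : j%:R * (2 * pi) / N%:R / 2 = pi * (j%:R / N%:R) :> R.
  by field; rewrite gt_eqF.
apply/andP; split; first by rewrite mulr_gt0 ?pi_gt0// divr_gt0// ltr0n.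
by rewrite gtr_pMr ?pi_gt0// ltr_pdivrMr// mul1r ltr_nat.
Qed.

Lemma sample_mean_cos (j : nat) : (j < N)%N ->
  sample_mean (fun x => cos (j%:R * x)) = (j == 0%N)%:R.
Proof.
move=> jN; have N0 : (N%:R : R) != 0 by rewrite pnatr_eq0 -lt0n (leq_ltn_trans _ jN).
rewrite /sample_mean; under eq_bigr do rewrite angleE.
case: (posnP j) => [->|j0].
  under eq_bigr do rewrite !mul0r mulr0 cos0.
  by rewrite sumr_const card_ord mulVf.
rewrite (_ : \sum_(k < N) _ = 0) ?mulr0//.
have sin0 := @sin_half_neq0 j; rewrite j0 jN in sin0; apply: (mulIf (sin0 isT)).
rewrite sum_cos mul0r.
have -> : N%:R * (j%:R * (2 * pi) / N%:R) = j%:R * (2 * pi) :> R by field.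
by rewrite sinB sin_2pi_nat cos_2pi_nat; ring.
Qed.

Lemma sample_mean_sin (j : nat) : (j < N)%N ->
  sample_mean (fun x => sin (j%:R * x)) = 0.
Proof.
move=> jN; have N0 : (N%:R : R) != 0 by rewrite pnatr_eq0 -lt0n (leq_ltn_trans _ jN).
rewrite /sample_mean; under eq_bigr do rewrite angleE.
case: (posnP j) => [->|j0].
  by under eq_bigr do rewrite !mul0r mulr0 sin0; rewrite big1 ?mulr0.
rewrite (_ : \sum_(k < N) _ = 0) ?mulr0//.
have sin0 := @sin_half_neq0 j; rewrite j0 jN in sin0; apply: (mulIf (sin0 isT)).
rewrite sum_sin mul0r.
have -> : N%:R * (j%:R * (2 * pi) / N%:R) = j%:R * (2 * pi) :> R by field.
by rewrite cosB sin_2pi_nat cos_2pi_nat; ring.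
Qed.

Lemma sample_mean_exact : trig_exact N sample_mean.
Proof.
split=> [f g _ _|c f _|j|j].
- by rewrite /sample_mean big_split/= mulrDr.
- by rewrite /sample_mean -mulr_sumr mulrCA.
- exact: sample_mean_cos.
- exact: sample_mean_sin.
Qed.

End SampleMean.

Section MeanBounds.
Context {R : realType} {d : measure_display} {Omega : measurableType d}.
Variable P : probability Omega R.
Variables (v : R -> Omega -> R) (f : R -> R) (K : R).
Hypothesis vK : forall x, 0 <= x < 2 * pi -> v x \in L2 P /\ l2norm P (v x) <= K.
Hypothesis f_le1 : forall x, `|f x| <= 1.

Lemma circle_mean_bound : measurable_fun setT (fun p : R * Omega => v p.1 p.2) ->
  measurable_fun setT f ->
  [/\ {ae P, forall w, (fun x => v x w * f x) \in L2 circle_prob},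
      (fun w => circle_mean (fun x => v x w * f x)) \in L2 P &
      l2norm P (fun w => circle_mean (fun x => v x w * f x)) <= K].
Proof.
move=> mv mf.
have mvf : measurable_fun setT (fun p : R * Omega => v p.1 p.2 * f p.1).
  by apply: measurable_funM => //; exact: measurableT_comp.
have -> : (fun w => circle_mean (fun x => v x w * f x)) =
    fun w => \int[circle_prob]_x (v x w * f x).
  apply/funext => w; apply: circle_meanE.
  exact: (measurableT_comp mvf (pair2_measurable w)).
have K0 : 0 <= K.
  have [|_] := vK (x := 0); first by rewrite lexx mulr_gt0 ?pi_gt0.
  exact/le_trans/l2norm_ge0.
suff vf_le : {ae circle_prob, forall x : R,
    (\int[P]_w ((v x w * f x) ^+ 2)%:E <= (K ^+ 2)%:E)%E}.
  pose vf x w := v x w * f x.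
  have [] := l2norm_average_le (nu := circle_prob) (u := vf) mvf vf_le K0.
  by split=> //; apply: (ae_section_L2 (nu := circle_prob) (u := vf) mvf vf_le).
apply: ae_circle_prob => x /vK[vL2 vxK].
apply: (@le_trans _ _ (\int[P]_w (v x w ^+ 2)%:E)%E).
  apply: ge0_le_integral => //.
  - by move=> w _; rewrite lee_fin sqr_ge0.
  - apply/measurable_EFinP/measurable_funX.
    exact: (measurableT_comp mvf (pair1_measurable x)).
  - by apply/measurable_EFinP/measurable_funX; exact: measurable_L2 vL2.
  - move=> w _; rewrite lee_fin exprMn -[leRHS]mulr1 ler_wpM2l ?sqr_ge0//.
    by rewrite -real_normK ?num_real// exprn_ile1.
by rewrite -EFin_sqr_l2norm// lee_fin ler_pXn2r ?nnegrE ?l2norm_ge0.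
Qed.

Lemma sample_mean_bound N : (0 < N)%N ->
  (fun w => sample_mean N (fun x => v x w * f x)) \in L2 P /\
  l2norm P (fun w => sample_mean N (fun x => v x w * f x)) <= K.
Proof.
move=> N0; pose F (k : 'I_N) := f (sample_point N k) *: v (sample_point N k).
have -> : (fun w => sample_mean N (fun x => v x w * f x)) =
    N%:R^-1 *: \sum_(k < N) F k.
  apply/funext => w; rewrite /sample_mean fct_sumE; congr (_ * _).
  by apply: eq_bigr => k _; rewrite mulrC.
have vkK (k : 'I_N) := vK (sample_point_itv (ltn_ord k)).
have FL2 k : F k \in L2 P by rewrite rpredZ//; have [] := vkK k.
have FK k : l2norm P (F k) <= K.
  have [vkL2 vk_le] := vkK k; rewrite l2normZ//; apply: le_trans vk_le.
  by rewrite ler_piMl ?l2norm_ge0.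
have sFL2 : \sum_(k < N) F k \in L2 P by exact: rpred_sum.
split; first by rewrite rpredZ.
rewrite l2normZ// ger0_norm ?invr_ge0// ler_pdivrMl ?ltr0n//.
apply: le_trans (ler_l2norm_sum _ FL2) _; apply: le_trans (ler_sum _ (fun k _ => FK k)) _.
by rewrite sumr_const card_ord mulr_natl.
Qed.

End MeanBounds.

Section FourierLimit.
Context {R : realType} {d : measure_display} {Omega : measurableType d}.
Variable P : probability Omega R.
Variables (u : R -> Omega -> R) (S_ : nat -> R -> Omega -> R) (e : nat -> R).
Hypothesis measurable_u : measurable_fun setT (fun p : R * Omega => u p.1 p.2).
Hypothesis measurable_S : forall n,
  measurable_fun setT (fun p : R * Omega => S_ n p.1 p.2).
Hypothesis continuous_S : forall n w, continuous (S_ n ^~ w).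
Hypothesis S0 : S_ 0 = fun=> 0.
Hypothesis uS : forall n x, 0 <= x < 2 * pi ->
  u x - S_ n x \in L2 P /\ l2norm P (u x - S_ n x) <= e n.
Hypothesis e_cvg0 : e @ \oo --> 0.

Variables (f : R -> R) (h : nat -> Omega -> R).
Hypothesis continuous_f : continuous f.
Hypothesis f_le1 : forall x, `|f x| <= 1.
Hypothesis hL2 : forall n, h n \in L2 P.
Hypothesis circle_S : forall n w, circle_mean (fun x => S_ n x w * f x) = h n w.

Let measurable_f : measurable_fun setT f. Proof. exact: continuous_measurable_fun. Qed.

Let uK x : 0 <= x < 2 * pi -> u x \in L2 P /\ l2norm P (u x) <= e 0.
Proof. by move=> /(uS 0); rewrite S0 subr0. Qed.

Lemma circle_mean_L2 : (fun w => circle_mean (fun x => u x w * f x)) \in L2 P.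
Proof. by have [] := circle_mean_bound uK f_le1 measurable_u measurable_f. Qed.

Lemma l2cvg_circle_mean : l2cvg P h (fun w => circle_mean (fun x => u x w * f x)).
Proof.
apply: l2cvg_le e_cvg0 => n.
have [ae_uf uf_L2 _] := circle_mean_bound uK f_le1 measurable_u measurable_f.
have measurable_Y : measurable_fun setT (fun p : R * Omega => (u p.1 - S_ n p.1) p.2).
  exact: measurable_funB.
have [_ YL2 Ye] := circle_mean_bound (uS n) f_le1 measurable_Y measurable_f.
rewrite l2normBC//; apply: le_trans Ye; rewrite le_eqVlt; apply/orP; left; apply/eqP.
apply: ae_eq_l2norm; [|exact: measurable_L2 YL2|].
  exact: measurable_L2 (rpredB uf_L2 (hL2 n)).
move: ae_uf; apply: filterS => w ufL2 /=; rewrite !fctE -circle_S.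
have continuous_Sf : continuous (fun x => S_ n x w * f x).
  by move=> x; apply: cvgM; [exact: continuous_S|exact: continuous_f].
have measurable_Sf : measurable_fun setT (fun x => S_ n x w * f x).
  exact: continuous_measurable_fun.
rewrite !circle_meanE//; last 2 first.
- apply: measurable_funM => //.
  exact: (measurableT_comp measurable_Y (pair2_measurable w)).
- exact: measurable_L2 ufL2.
rewrite -RintegralB//; last 2 first.
- exact: integrable_L2.
- by apply: integrable_L2; exact: continuous_L2_circle.
by apply: eq_Rintegral => x _; rewrite mulrBl.
Qed.

Variable N : nat -> nat.
Hypothesis N0 : forall n, (0 < N n)%N.
Hypothesis sample_S : forall n w, sample_mean (N n) (fun x => S_ n x w * f x) = h n w.

Lemma sample_mean_L2 n : (fun w => sample_mean (N n) (fun x => u x w * f x)) \in L2 P.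
Proof. by have [] := sample_mean_bound uK f_le1 (N0 n). Qed.

Lemma l2cvg_sample_mean :
  l2cvg P (fun n w => sample_mean (N n) (fun x => u x w * f x))
    (fun w => circle_mean (fun x => u x w * f x)).
Proof.
pose D n w := sample_mean (N n) (fun x => u x w * f x).
have DL2 n : D n - h n \in L2 P by rewrite rpredB ?sample_mean_L2.
have cDh : l2cvg P (fun n => D n - h n) 0.
  apply: l2cvg_le e_cvg0 => n; rewrite subr0.
  have [_] := sample_mean_bound (uS n) f_le1 (N0 n); apply: le_trans.
  rewrite le_eqVlt; apply/orP; left; apply/eqP; congr l2norm; apply/funext => w.
  rewrite !fctE -sample_S /D /sample_mean -mulrBr -sumrB; congr (_ * _).
  by apply: eq_bigr => k _; rewrite mulrBl.
have := l2cvgD DL2 hL2 (rpred0 _) circle_mean_L2 cDh l2cvg_circle_mean.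
by rewrite add0r; congr l2cvg; apply/funext => n; rewrite subrK.
Qed.

End FourierLimit.

(** * Partial sums of the expansion *)

Section HarmonicIndices.

Definition sh_index (n k : nat) : seq (nat * nat * bool) :=
  [seq (lm, b) | lm <- [seq (l, m) | l <- index_iota n k, m <- index_iota 0 l.+1],
                 b <- [:: false; true]].

Lemma mem_sh_index n k l m b :
  ((l, m, b) \in sh_index n k) = (n <= l < k)%N && (m <= l)%N.
Proof.
apply/allpairsP/andP => [[[lm b'] [lm_in _ [lmE _]]]|[nlk ml]].
  case: _ / lmE lm_in => /allpairsPdep[l' [m' [l'_in m'_in [-> ->]]]].
  by move: l'_in m'_in; rewrite !mem_index_iota ltnS.
exists (l, m, b); split=> //; last by case: b.
by apply/allpairsPdep; exists l, m; rewrite !mem_index_iota ltnS.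
Qed.

Lemma sh_index_uniq n k : uniq (sh_index n k).
Proof.
apply: allpairs_uniq => //; last by move=> [lm b] [lm' b'].
apply: allpairs_uniq_dep; first exact: iota_uniq.
- by move=> l _; exact: iota_uniq.
- by move=> [l m] [l' m'] _ _ /= [-> ->].
Qed.

Lemma big_sh_index (V : nmodType) n k (F : nat * nat * bool -> V) :
  \sum_(i <- sh_index n k) F i =
  \sum_(n <= l < k) \sum_(0 <= m < l.+1) (F (l, m, false) + F (l, m, true)).
Proof.
rewrite big_allpairs big_allpairs_dep; apply: eq_bigr => l _; apply: eq_bigr => m _.
by rewrite big_cons big_seq1.
Qed.

Lemma big_sh_index_cat (V : nmodType) n k (F : nat * nat * bool -> V) : (n <= k)%N ->
  \sum_(i <- sh_index 0 k) F i =
  \sum_(i <- sh_index 0 n) F i + \sum_(i <- sh_index n k) F i.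
Proof. by move=> nk; rewrite !big_sh_index (big_cat_nat (leq0n n) nk). Qed.

Lemma big_sh_index_order (V : nmodType) n m b (F : nat * nat * bool -> V) :
  \sum_(i <- sh_index 0 n | (i.1.2 == m) && (i.2 == b)) F i =
  \sum_(m <= l < n) F (l, m, b).
Proof.
rewrite big_mkcond big_sh_index (big_nat_widenl m 0)//= [RHS]big_mkcond.
apply: eq_bigr => l _; transitivity (\sum_(0 <= j < l.+1 | j == m) F (l, j, b)).
  rewrite [RHS]big_mkcond; apply: eq_bigr => j _; rewrite /=.
  by case: eqP => _; case: (b); rewrite /= ?addr0 ?add0r.
by rewrite big_nat1_eq ltnS.
Qed.

End HarmonicIndices.

Section RealCoefficients.
Context {R : realType} {d : measure_display} {Omega : measurableType d}.
Variables (P : probability Omega R) (C : nat -> R).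
Variable a : nat -> int -> Omega -> R[i].
Hypothesis C_ge0 : forall l, 0 <= C l.
Hypothesis coefP : harmonic_coefficients P C a.

(* [Im a_l0] vanishes only almost surely; it is replaced by 0. *)
Definition rcoef (i : nat * nat * bool) : Omega -> R :=
  if i.2 && (i.1.2 == 0%N) then 0 else fun w => cpart i.2 (a i.1.1 i.1.2%:Z w).

Lemma measurable_coef l m : (m <= l)%N ->
  measurable_fun setT (fun w => cpair (a l m%:Z w)).
Proof. by move=> ml; apply: (coef_measurable coefP); rewrite /= lez_nat. Qed.

Lemma rcoef_normal l m b : (m <= l)%N ->
  has_normal_law P (rcoef (l, m, b)) 0 (C l * wave_sqmean b m).
Proof.
rewrite /rcoef /wave_sqmean /=; have [-> _|m0 ml] := posnP m.
  case: b => /=; last by rewrite mulr1; have [_] := coef_zero coefP l.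
  by rewrite mulr0; apply/has_normal_law0; split; [exact: measurable_cst|exact: aeW].
rewrite andbF; have [_ nRe nIm] := coef_pos coefP (introT andP (conj m0 ml)).
by case: b.
Qed.

Let sqmean_ge0 l m b : 0 <= C l * wave_sqmean b m.
Proof. by rewrite mulr_ge0// /wave_sqmean; case: ifP. Qed.

Lemma rcoef_L2 l m b : (m <= l)%N -> rcoef (l, m, b) \in L2 P.
Proof. by move=> /(@rcoef_normal l m b); exact: normal_law_L2. Qed.

Lemma rcoef_mean l m b : (m <= l)%N -> \int[P]_w rcoef (l, m, b) w = 0.
Proof. by move=> /(@rcoef_normal l m b); exact: normal_law_mean. Qed.

Lemma rcoef_variance l m b : (m <= l)%N ->
  l2dot P (rcoef (l, m, b)) (rcoef (l, m, b)) = C l * wave_sqmean b m.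
Proof.
move=> ml; rewrite -sqr_l2norm ?rcoef_L2//.
by have [_] := normal_law_variance (sqmean_ge0 l m b) (rcoef_normal b ml); rewrite subr0.
Qed.

Lemma coef_independent_pair l m b l' m' b' :
  (m <= l)%N -> (m' <= l')%N -> (l, m) != (l', m') ->
  independent_rv P (fun w => cpart b (a l m%:Z w)) (fun w => cpart b' (a l' m'%:Z w)).
Proof.
move=> ml ml' neq U V mU mV.
pose F i := if i == (l, m) then cproj b @^-1` U else cproj b' @^-1` V.
have mF i : measurable (F i).
  by rewrite /F; case: ifP => _; rewrite -[X in measurable X]setTI;
    exact: measurable_cproj.
have lm_uniq : uniq [:: (l, m); (l', m')] by rewrite /= inE neq.
have lm_le i : i \in [:: (l, m); (l', m')] -> (i.2 <= i.1)%N.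
  by rewrite !inE => /orP[/eqP ->|/eqP ->].
have := coef_independent coefP lm_uniq lm_le mF.
rewrite !big_cons big_nil mule1 /F eqxx eq_sym (negbTE neq) => <-.
congr (P _); apply/seteqP; split=> w /=.
  move=> [Uw Vw] i; rewrite !inE => /orP[/eqP ->|/eqP ->]; first by rewrite eqxx.
  by rewrite eq_sym (negbTE neq).
move=> Fw; split; first by have := Fw (l, m); rewrite mem_head eqxx; apply.
by have := Fw (l', m'); rewrite !inE eqxx orbT eq_sym (negbTE neq); apply.
Qed.

Lemma rcoef_re_im_orthogonal l m : (m <= l)%N ->
  l2dot P (rcoef (l, m, false)) (rcoef (l, m, true)) = 0.
Proof.
move=> ml; have [m0|m0] := posnP m.
  by rewrite l2dotC [X in l2dot P X _]/rcoef /= m0 l2dot0l.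
have [ReIm _ _] := coef_pos coefP (introT andP (conj m0 ml)).
rewrite independent_l2dot ?rcoef_L2 ?rcoef_mean ?mul0r//.
by rewrite /rcoef /= gtn_eqF.
Qed.

Lemma rcoef_orthogonal l m b l' m' b' : (m <= l)%N -> (m' <= l')%N ->
  (l, m, b) != (l', m', b') -> l2dot P (rcoef (l, m, b)) (rcoef (l', m', b')) = 0.
Proof.
move=> ml ml'; have [[<- <-] bb'|lm_neq _] := eqVneq (l, m) (l', m').
  case: b b' bb' => -[]; rewrite ?eqxx// => _; last exact: rcoef_re_im_orthogonal.
  by rewrite l2dotC rcoef_re_im_orthogonal.
have [zero|nz] := boolP (b && (m == 0%N)); first by rewrite /rcoef /= zero l2dot0l.
have [zero'|nz'] := boolP (b' && (m' == 0%N)).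
  by rewrite l2dotC [X in l2dot P X _]/rcoef /= zero' l2dot0l.
rewrite independent_l2dot ?rcoef_L2 ?rcoef_mean ?mul0r//.
by rewrite /rcoef /= (negbTE nz) (negbTE nz'); exact: coef_independent_pair.
Qed.

End RealCoefficients.

Section RealPartialSums.
Context {R : realType} {d : measure_display} {Omega : measurableType d}.
Variables (P : probability Omega R) (C : nat -> R).
Variable a : nat -> int -> Omega -> R[i].
Hypothesis C_ge0 : forall l, 0 <= C l.
Hypothesis coefP : harmonic_coefficients P C a.
Implicit Types (x z : R) (m n k : nat).

Local Notation rcoef := (rcoef a).
Local Notation rcoef_L2 := (rcoef_L2 C_ge0 coefP).

(* The terms of orders m and - m of the expansion are conjugate, so that for m > 0
   they add up to twice a real part. *)
Definition sh_multiplicity m : R := if m == 0%N then 1 else 2.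

Definition real_harmonic z x (i : nat * nat * bool) : R :=
  sh_multiplicity i.1.2 * Llm i.1.1 i.1.2%:Z z * wave i.2 i.1.2 x.

Definition coef_sum z n x : Omega -> R :=
  \sum_(i <- sh_index 0 n) real_harmonic z x i *: rcoef i.

Definition fourier_sum (b : bool) m z n : Omega -> R :=
  \sum_(m <= l < n) Llm l m%:Z z *: rcoef (l, m, b).

Lemma coef_sumE z n x w :
  coef_sum z n x w = \sum_(i <- sh_index 0 n) real_harmonic z x i * rcoef i w.
Proof. by rewrite /coef_sum fct_sumE. Qed.

Lemma continuous_coef_sum z n w : continuous (fun x => coef_sum z n x w).
Proof.
under eq_fun do rewrite coef_sumE.
apply: continuous_sum => i x; apply: cvgM; last exact: cvg_cst.
by apply: cvgM; [exact: cvg_cst|exact: continuous_wave].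
Qed.

Lemma sh_index_L2 n k : {in sh_index n k, forall i, rcoef i \in L2 P}.
Proof. by move=> [[l m] b]; rewrite mem_sh_index => /andP[_ /rcoef_L2]. Qed.

Lemma measurable_coef_sum z n :
  measurable_fun setT (fun p : R * Omega => coef_sum z n p.1 p.2).
Proof.
have -> : (fun p : R * Omega => coef_sum z n p.1 p.2) = fun p =>
    \sum_(i <- sh_index 0 n)
      if i \in sh_index 0 n then real_harmonic z p.1 i * rcoef i p.2 else 0.
  by apply/funext => p; rewrite coef_sumE big_seq big_mkcond.
apply: measurable_sum => i; case: (boolP (i \in _)) => [i_in|_] //.
have mr : measurable_fun setT (rcoef i) := measurable_L2 (sh_index_L2 i_in).
apply: measurable_funM; last exact: measurableT_comp.
apply: measurable_funM => //; apply: measurableT_comp => //.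
exact: continuous_measurable_fun (@continuous_wave R _ _).
Qed.

Lemma coef_sum_L2 z n x : coef_sum z n x \in L2 P.
Proof.
by rewrite /coef_sum big_seq rpred_sum// => i /sh_index_L2 ?; rewrite rpredZ.
Qed.

Lemma coef_sum_diff z n k x : (n <= k)%N ->
  coef_sum z k x - coef_sum z n x =
  \sum_(i <- sh_index n k) real_harmonic z x i *: rcoef i.
Proof. by move=> nk; rewrite /coef_sum (big_sh_index_cat _ nk) addrAC subrr add0r. Qed.

Lemma l2norm_coef_sum_diff z n k x : (n <= k)%N ->
  l2norm P (coef_sum z k x - coef_sum z n x) =
  l2norm P (coef_sum z k 0 - coef_sum z n 0).
Proof.
move=> nk; suff sqrE y : l2norm P (coef_sum z k y - coef_sum z n y) ^+ 2 =
    \sum_(n <= l < k) \sum_(0 <= m < l.+1)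
      (sh_multiplicity m * Llm l m%:Z z) ^+ 2 * (C l * wave_sqmean false m).
  by apply/eqP; rewrite -(@eqrXn2 _ 2)// ?l2norm_ge0// !sqrE.
rewrite sqr_l2norm ?rpredB ?coef_sum_L2// coef_sum_diff//.
rewrite l2dot_orthogonal_sum; last 4 first.
- exact: sh_index_uniq.
- exact: sh_index_L2.
- exact: sh_index_L2.
- move=> [[l m] b] [[l' m'] b']; rewrite !mem_sh_index => /andP[_ ml] /andP[_ ml'].
  exact: (rcoef_orthogonal C_ge0 coefP).
rewrite big_sh_index; apply: eq_bigr => l _; rewrite !big_seq; apply: eq_bigr => m.
rewrite mem_index_iota ltnS => ml; rewrite !(rcoef_variance C_ge0 coefP)//.
rewrite /real_harmonic !waveE /wave_sqmean /=.
have [->|_] := eqVneq m 0%N; first by rewrite mul0r cos0 sin0; ring.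
by rewrite -[RHS]mulr1 -[X in _ = _ * X](cos2Dsin2 (m%:R * y)); field.
Qed.

Lemma mean_coef_sum (N : nat) (mean : (R -> R) -> R) z n m b :
  trig_exact N mean -> (n + m <= N)%N ->
  forall w, mean (fun x => coef_sum z n x w * wave b m x) = fourier_sum b m z n w.
Proof.
move=> exactN nmN w; have [_ meanZ _ _] := exactN.
pose c (i : nat * nat * bool) :=
  sh_multiplicity i.1.2 * Llm i.1.1 i.1.2%:Z z * rcoef i w.
pose W (i : nat * nat * bool) x := wave i.2 i.1.2 x * wave b m x.
have cW i : continuous (W i).
  by move=> x; apply: cvgM; exact: continuous_wave.
transitivity (mean (fun x => \sum_(i <- sh_index 0 n) (c i \*: W i) x)).
  congr mean; apply/funext => x; rewrite coef_sumE mulr_suml; apply: eq_bigr => i _.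
  by rewrite -[RHS]/(c i * W i x) /c /W /real_harmonic; ring.
rewrite (mean_sum exactN _ (F := fun i => c i \*: W i)); last first.
  by move=> i x; apply: cvgM; [exact: cvg_cst|exact: cW].
rewrite /fourier_sum fct_sumE.
rewrite -(big_sh_index_order n m b (fun i => Llm i.1.1 m%:Z z * rcoef i w)).
rewrite [RHS]big_mkcond !big_seq; apply: eq_bigr => -[[l j] b'].
rewrite mem_sh_index => /andP[/andP[_ ln] jl]; rewrite meanZ// /W /=.
rewrite (mean_waveM exactN); last by lia.
rewrite andbC; case: eqP => [->|_] /=; last by rewrite mul0r mulr0.
case: eqP => [->|_]; last by rewrite mul0r mulr0.
rewrite mul1r /c /= /sh_multiplicity /wave_sqmean /rcoef /=.
by case: eqP => _; case: (b) => /=; rewrite ?mulr0 ?mul1r ?mulr1//; field.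
Qed.

Lemma fourier_sum_L2 b m z n : fourier_sum b m z n \in L2 P.
Proof.
rewrite /fourier_sum big_seq rpred_sum// => l; rewrite mem_index_iota => /andP[ml _].
by rewrite rpredZ ?rcoef_L2.
Qed.

Lemma l2dot_fourier_sum b b' m z1 z2 n :
  l2dot P (fourier_sum b m z1 n) (fourier_sum b' m z2 n) =
  (b == b')%:R * wave_sqmean b m *
  \sum_(m <= l < n) C l * Llm l m%:Z z1 * Llm l m%:Z z2.
Proof.
have rL2 b1 : {in index_iota m n, forall l, rcoef (l, m, b1) \in L2 P}.
  by move=> l; rewrite mem_index_iota => /andP[ml _]; exact: rcoef_L2.
rewrite /fourier_sum l2dot_orthogonal_sum ?iota_uniq//.
  rewrite mulr_sumr !big_seq; apply: eq_bigr => l; rewrite mem_index_iota => /andP[ml _].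
  case: eqP => [<-|/eqP bb']; first by rewrite (rcoef_variance C_ge0 coefP)// mul1r; ring.
  rewrite (rcoef_orthogonal C_ge0 coefP)//; first by rewrite !mul0r mulr0.
  by apply: contraNneq bb' => -[->].
move=> l l'; rewrite !mem_index_iota => /andP[ml _] /andP[ml' _] ll'.
rewrite (rcoef_orthogonal C_ge0 coefP)//.
by apply: contraNneq ll' => -[->].
Qed.

End RealPartialSums.

Lemma big_int_symmetric (V : nmodType) (l : nat) (F : int -> V) :
  \sum_(j < (2 * l).+1) F (j%:Z - l%:Z) =
  F 0 + \sum_(k < l) (F (Posz k.+1) + F (Negz k)).
Proof.
have -> : (2 * l).+1 = (l + l.+1)%N by rewrite addnS mul2n addnn.
rewrite big_split_ord/= big_split/= addrA [RHS]addrC; congr (_ + _).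
  rewrite (reindex_inj rev_ord_inj)/=; apply: eq_bigr => k _; congr F.
  by rewrite NegzE -subzn ?ltn_ord// addrAC subrr add0r.
rewrite big_ord_recl/=; congr (_ + _); last apply: eq_bigr => k _; congr F.
  by rewrite addn0 subrr.
by rewrite /bump/= PoszD addrC addKr.
Qed.

Section ComplexPartialSums.
Context {R : realType} {d : measure_display} {Omega : measurableType d}.
Variables (P : probability Omega R) (C : nat -> R).
Variable a : nat -> int -> Omega -> R[i].
Hypothesis coefP : harmonic_coefficients P C a.

Lemma coef_conjugation : {ae P, forall w, forall l : nat,
  complex.Im (a l 0 w) = 0 /\
  forall m, (m < l)%N -> a l (Negz m) w = (-1) ^+ m.+1 * conjc (a l m.+1%:Z w)}.
Proof.
apply: ae_foralln => l; have [Im0 _] := coef_zero coefP l.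
suff : {ae P, forall w, forall m, (m < l)%N ->
    a l (Negz m) w = (-1) ^+ m.+1 * conjc (a l m.+1%:Z w)} by apply: filterS2 Im0.
apply: ae_foralln => m; have [ml|ml] := ltnP m l; last by apply: aeW => w.
by have := coef_neg coefP (l := l) (m := m.+1) ml; apply: filterS => w /= <-.
Qed.

Lemma partial_sum_coef_sum : {ae P, forall w, forall n theta phi,
  partial_sum a n theta phi w = (coef_sum a (cos theta) n phi w)%:C}.
Proof.
apply: filterS coef_conjugation => w conj_a n theta phi.
rewrite coef_sumE big_sh_index big_mkord rmorph_sum; apply: eq_bigr => l _.
have [a0 aN] := conj_a l.
rewrite (big_int_symmetric l (fun m => a l m w * Ylm l m theta phi)).
rewrite big_mkord big_ord_recl rmorphD rmorph_sum.
rewrite /real_harmonic /rcoef /sh_multiplicity; congr (_ + _).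
  rewrite !waveE /= /Ynat /expi !mul0r cos0 sin0 mulr0 addr0.
  case: (a l 0 w) a0 => x y /= ->.
  by apply/eqP; rewrite eq_complex /=; apply/andP; split; apply/eqP; ring.
apply: eq_bigr => k _; rewrite (aN _ (ltn_ord k)) !waveE /= /Ynat.
rewrite mulrACA -expr2 sqrr_sign mul1r /expi /bump /= add1n.
case: (a l k.+1%:Z w) => x y; rewrite /cpart /cproj /cpair /=.
by apply/eqP; rewrite eq_complex /=; apply/andP; split; apply/eqP; ring.
Qed.

Lemma measurable_partial_sum b n theta phi :
  measurable_fun setT (fun w => cpart b (partial_sum a n theta phi w)).
Proof.
pose y l (j : nat) := Ylm l (j%:Z - l%:Z) theta phi.
pose A b' l (j : nat) w := cpart b' (a l (j%:Z - l%:Z) w).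
have -> : (fun w => cpart b (partial_sum a n theta phi w)) =
    fun w => \sum_(l < n) \sum_(j < (2 * l).+1)
      (cpart b (y l j) * A false l j w
       + (-1) ^+ (~~ b) * cpart (~~ b) (y l j) * A true l j w).
  apply/funext => w; rewrite /A /y /cpart /partial_sum.
  case: b; rewrite /= raddf_sum; apply: eq_bigr => l _; rewrite raddf_sum;
    by apply: eq_bigr => j _; case: (a _ _ w) (Ylm _ _ _ _) => ? ? [? ?] /=; ring.
apply: measurable_sum => l; apply: measurable_sum => j.
have ma : measurable_fun setT (fun w => cpair (a l (j%:Z - l%:Z) w)).
  by apply: (coef_measurable coefP); have := ltn_ord j; lia.
have mA b' : measurable_fun setT (A b' l j).
  exact: (measurableT_comp (measurable_cproj b') ma).
by apply: measurable_funD; apply: measurable_funM.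
Qed.

End ComplexPartialSums.

(** * The Fourier modes of the field *)

Section LinearSpan.
Context {K : pzRingType} {V : lmodType K} {I : eqType}.
Variables (D : set I) (X : I -> V).

Definition linear_span : set V :=
  [set Y | exists2 s : seq (K * I), {in s, forall p, D p.2} &
           Y = \sum_(p <- s) p.1 *: X p.2].

Lemma linear_span_gen i : D i -> linear_span (X i).
Proof.
move=> Di; exists [:: (1, i)]; first by move=> p; rewrite inE => /eqP ->.
by rewrite big_seq1 scale1r.
Qed.

Lemma linear_span0 : linear_span 0.
Proof. by exists [::] => //; rewrite big_nil. Qed.

Lemma linear_spanD Y Z : linear_span Y -> linear_span Z -> linear_span (Y + Z).
Proof.
move=> [s sD ->] [t tD ->]; exists (s ++ t); last by rewrite big_cat.
by move=> p; rewrite mem_cat => /orP[/sD|/tD].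
Qed.

Lemma linear_spanZ c Y : linear_span Y -> linear_span (c *: Y).
Proof.
move=> [s sD ->]; exists [seq (c * p.1, p.2) | p <- s].
  by move=> _ /mapP[p /sD pD ->].
by rewrite big_map scaler_sumr; apply: eq_bigr => p _; rewrite scalerA.
Qed.

Lemma linear_span_sum (J : Type) (r : seq J) (F : J -> V) :
  (forall j, linear_span (F j)) -> linear_span (\sum_(j <- r) F j).
Proof. by move=> FS; apply: big_ind; [exact: linear_span0|exact: linear_spanD|]. Qed.

End LinearSpan.

Section GaussianSpace.
Context {R : realType} {d : measure_display} {Omega : measurableType d}.
Variables (P : probability Omega R) (I : eqType) (D : set I) (X : I -> Omega -> R).
Local Notation linear_span := (linear_span D X).

Definition l2_closed_span : set (Omega -> R) :=
  [set Y | Y \in L2 P /\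
           exists2 Y_ : nat -> Omega -> R, forall n, linear_span (Y_ n) & l2cvg P Y_ Y].

Hypothesis span_gaussian : forall Y, linear_span Y -> gaussian_rv P Y.
Hypothesis X_mean : forall i, D i -> \int[P]_w X i w = 0.

Lemma linear_span_L2 Y : linear_span Y -> Y \in L2 P.
Proof. by move=> /span_gaussian[m [v [v0 nY]]]; exact: normal_law_L2 nY. Qed.

Lemma linear_span_mean Y : linear_span Y -> \int[P]_w Y w = 0.
Proof.
move=> [s sD ->]; rewrite -l2dot_cst1 big_seq l2dot_suml ?cst_L2//; last first.
  by move=> p /sD/(linear_span_gen X)/linear_span_L2; exact: rpredZ.
rewrite big1// => p /sD pD; rewrite l2dotZl ?cst_L2 ?l2dot_cst1 ?X_mean ?mulr0//.
exact/linear_span_L2/linear_span_gen.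
Qed.

Lemma l2_closed_span0 : l2_closed_span 0.
Proof.
split; first exact: rpred0.
by exists (fun=> 0); [move=> _; exact: linear_span0|exact: l2cvg_cst].
Qed.

Lemma l2_closed_spanD Y Z :
  l2_closed_span Y -> l2_closed_span Z -> l2_closed_span (Y + Z).
Proof.
move=> [YL2 [Y_ Y_S cY]] [ZL2 [Z_ Z_S cZ]]; split; first exact: rpredD.
exists (fun n => Y_ n + Z_ n); first by move=> n; exact: linear_spanD.
by apply: l2cvgD => // n; exact: linear_span_L2.
Qed.

Lemma l2_closed_spanZ c Y : l2_closed_span Y -> l2_closed_span (c *: Y).
Proof.
move=> [YL2 [Y_ Y_S cY]]; split; first exact: rpredZ.
exists (fun n => c *: Y_ n); first by move=> n; exact: linear_spanZ.
by apply: l2cvgZ => // n; exact: linear_span_L2.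
Qed.

Lemma l2_closed_span_sum (J : Type) (r : seq J) (F : J -> Omega -> R) :
  (forall j, l2_closed_span (F j)) -> l2_closed_span (\sum_(j <- r) F j).
Proof.
by move=> FS; apply: big_ind; [exact: l2_closed_span0|exact: l2_closed_spanD|].
Qed.

Lemma l2_closed_span_gaussian Y : l2_closed_span Y -> gaussian_rv P Y.
Proof.
move=> [YL2 [Y_ Y_S cY]]; exists 0, (l2norm P Y ^+ 2); split; first exact: sqr_ge0.
apply: gaussian_l2_limit cY => // [n|n|n c].
- exact: linear_span_L2.
- exact: linear_span_mean.
- exact/span_gaussian/linear_spanZ.
Qed.

Lemma l2_closed_span_mean Y : l2_closed_span Y -> \int[P]_w Y w = 0.
Proof.
move=> [YL2 [Y_ Y_S cY]]; have Y_L2 n := linear_span_L2 (Y_S n).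
have := l2cvg_Rintegral Y_L2 YL2 cY.
under eq_cvg do rewrite (linear_span_mean (Y_S _)).
by move=> /cvg_unique; apply; [exact: Rhausdorff|exact: cvg_cst].
Qed.

End GaussianSpace.

Section SphereGeometry.
Context {R : realType}.

Lemma sphere_spoint (theta phi : R) : sphere (spoint theta phi).
Proof.
rewrite /sphere /spoint /= !exprMn -mulrDr cos2Dsin2 mulr1 addrC.
exact: cos2Dsin2.
Qed.

Lemma measurable_sphere : measurable (@sphere R).
Proof.
have m1 : measurable_fun setT (fun x : R * R * R => x.1.1).
  exact: (measurableT_comp measurable_fst measurable_fst).
have m2 : measurable_fun setT (fun x : R * R * R => x.1.2).
  exact: (measurableT_comp measurable_snd measurable_fst).
have msq : measurable_fun setT
    (fun x : R * R * R => x.1.1 ^+ 2 + x.1.2 ^+ 2 + x.2 ^+ 2).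
  by apply: measurable_funD; [apply: measurable_funD|]; exact: measurable_funX.
by have := msq measurableT _ (measurable_set1 1); rewrite setTI.
Qed.

Lemma measurable_spoint {d : measure_display} {S : measurableType d}
    (theta phi : S -> R) : measurable_fun setT theta -> measurable_fun setT phi ->
  measurable_fun setT (fun s => spoint (theta s) (phi s)).
Proof.
move=> mtheta mphi; rewrite /spoint.
have msin : measurable_fun setT (@sin R).
  exact: continuous_measurable_fun (@continuous_sin R).
have mcos : measurable_fun setT (@cos R).
  exact: continuous_measurable_fun (@continuous_cos R).
apply: measurable_fun_pair; first apply: measurable_fun_pair.
- by apply: measurable_funM; exact: measurableT_comp.
- by apply: measurable_funM; exact: measurableT_comp.
- exact: measurableT_comp.
Qed.

Lemma measurable_segment11 : measurable (@segment11 R).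
Proof.
have -> : @segment11 R = `[-1, 1]%classic; last exact: measurable_itv.
by apply/seteqP; split=> x; rewrite /= in_itv.
Qed.

Lemma measurable_acos : measurable_fun (@segment11 R) (@acos R).
Proof.
have -> : @segment11 R = `]-1, 1[ `|` ([set -1] `|` [set 1]).
  apply/seteqP; split=> x; rewrite /segment11 /= in_itv/=.
    move=> /andP[]; rewrite le_eqVlt => /predU1P[<- _|x1]; first by right; left.
    rewrite le_eqVlt => /predU1P[->|x2]; first by right; right.
    by left; rewrite x1.
  by move=> [/andP[]|[->|->]]; lra.
apply/measurable_funU => //; first by apply: measurableU.
split; last by apply/measurable_funU => //; split; exact: measurable_fun_set1.
apply: open_continuous_measurable_fun; first exact: interval_open.
by move=> x; rewrite inE /= in_itv/= => ?; exact: continuous_acos.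
Qed.

End SphereGeometry.

Section SphericalField.
Context {R : realType} {d : measure_display} {Omega : measurableType d}.
Variables (P : probability Omega R) (T : R * R * R -> Omega -> R) (C : nat -> R).
Variable a : nat -> int -> Omega -> R[i].
Hypothesis T_gaussian : gaussian_field P (@sphere R) (fun x w => (T x w)%:C).

Lemma field_span_gaussian Y : linear_span (@sphere R) T Y -> gaussian_rv P Y.
Proof.
move=> [s s_sphere ->]; pose p0 : R * (R * R * R) := (0, (0, 0, 0)).
have s_sphere_nth (j : 'I_(size s)) : sphere (nth p0 s j).2 by apply/s_sphere/mem_nth.
have := T_gaussian.2 _ _ (fun j : 'I_(size s) => (nth p0 s j).1) (fun=> 0) s_sphere_nth.
congr (gaussian_rv P); apply/funext => w.
rewrite (big_nth p0) big_mkord fct_sumE; apply: eq_bigr => j _.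
by rewrite /= mul0r addr0.
Qed.

Lemma field_L2 x : sphere x -> T x \in L2 P.
Proof. by move=> /(linear_span_gen T)/(linear_span_L2 field_span_gaussian). Qed.

Lemma measurable_field_spoint {dS : measure_display} {S : measurableType dS}
    (theta phi : S -> R) (om : S -> Omega) :
  measurable_fun setT theta -> measurable_fun setT phi -> measurable_fun setT om ->
  measurable_fun setT (fun s => T (spoint (theta s) (phi s)) (om s)).
Proof.
move=> mtheta mphi mom.
have mT : measurable_fun (@sphere R `*` [set: Omega])
    (fun p : (R * R * R) * Omega => T p.1 p.2).
  exact: (measurableT_comp (@measurable_fst _ _ R R) T_gaussian.1).
apply: (measurable_comp (F := @sphere R `*` [set: Omega])
  (f := fun p => T p.1 p.2) (g := fun s => (spoint (theta s) (phi s), om s))) => //.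
- by apply: measurableX => //; exact: measurable_sphere.
- by move=> _ [s _ <-]; split=> //=; exact: sphere_spoint.
- by apply: measurable_fun_pair => //; exact: measurable_spoint.
Qed.

Hypothesis C_ge0 : forall l, 0 <= C l.
Hypothesis coefP : harmonic_coefficients P C a.

Lemma sq_errorE n theta phi : sq_error P T a n theta phi =
  (l2norm P (coef_sum a (cos theta) n phi - T (spoint theta phi)) ^+ 2)%:E.
Proof.
have TL2 : T (spoint theta phi) \in L2 P by apply/field_L2/sphere_spoint.
have SL2 := coef_sum_L2 C_ge0 coefP (cos theta) n phi.
have mT := measurable_L2 TL2; have mp b := measurable_partial_sum coefP b n theta phi.
rewrite EFin_sqr_l2norm ?rpredB// /sq_error.
have -> : (fun w => (Normc.normc
      ((T (spoint theta phi) w)%:C - partial_sum a n theta phi w) ^+ 2)%:E) =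
    (fun w => ((T (spoint theta phi) w - cpart false (partial_sum a n theta phi w)) ^+ 2
      + cpart true (partial_sum a n theta phi w) ^+ 2)%:E).
  apply/funext => w; case: (partial_sum _ _ _ _ _) => x y; congr EFin.
  by rewrite /cpart /= sqr_sqrtr ?addr_ge0 ?sqr_ge0// sub0r sqrrN.
apply: ae_eq_integral => //.
- apply/measurable_EFinP; apply: measurable_funD; apply: measurable_funX => //.
  exact: measurable_funB.
- by apply/measurable_EFinP/measurable_funX; exact: measurable_L2 (rpredB SL2 TL2).
- have := partial_sum_coef_sum coefP; apply: filterS => w sumE _.
  by rewrite sumE /cpart /= expr0n addr0 -sqrrN opprB.
Qed.

Hypothesis expP : forall theta phi : R, 0 <= theta <= pi -> 0 <= phi < 2 * pi ->
  sq_error P T a n theta phi @[n --> \oo] --> 0%E.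

Lemma l2cvg_coef_sum theta phi : 0 <= theta <= pi -> 0 <= phi < 2 * pi ->
  l2cvg P (fun n => coef_sum a (cos theta) n phi) (T (spoint theta phi)).
Proof.
move=> theta_pi phi_2pi; have := expP theta_pi phi_2pi.
under eq_cvg do rewrite sq_errorE; move/fine_cvg => sqr_cvg.
have := continuous_cvg _ (@sqrt_continuous R 0) sqr_cvg; rewrite sqrtr0.
by under eq_cvg do rewrite /= sqrtr_sqr ger0_norm ?l2norm_ge0//; apply.
Qed.

(* The differences of partial sums have constant norm along a circle of latitude,
   and so do the remainders in the limit. *)
Lemma l2norm_remainder theta phi n : 0 <= theta <= pi -> 0 <= phi < 2 * pi ->
  l2norm P (T (spoint theta phi) - coef_sum a (cos theta) n phi) =
  l2norm P (T (spoint theta 0) - coef_sum a (cos theta) n 0).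
Proof.
move=> theta_pi phi_2pi; have SL2 := coef_sum_L2 C_ge0 coefP (cos theta).
have remainder_lim x : 0 <= x < 2 * pi ->
    l2norm P (coef_sum a (cos theta) k 0 - coef_sum a (cos theta) n 0) @[k --> \oo] -->
    l2norm P (T (spoint theta x) - coef_sum a (cos theta) n x).
  move=> x_2pi; have TL2 := field_L2 (sphere_spoint theta x).
  have cS : l2cvg P (fun k => coef_sum a (cos theta) k x - coef_sum a (cos theta) n x)
      (T (spoint theta x) - coef_sum a (cos theta) n x).
    rewrite /l2cvg; under eq_cvg do rewrite opprB addrA subrK.
    exact: l2cvg_coef_sum.
  have := l2cvg_norm (fun k => rpredB (SL2 k x) (SL2 n x)) (rpredB TL2 (SL2 n x)) cS.
  apply: cvg_trans; apply: near_eq_cvg; exists n => // k /= nk.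
  by rewrite -(l2norm_coef_sum_diff C_ge0 coefP _ x nk).
apply: cvg_unique (remainder_lim phi phi_2pi) (remainder_lim 0 _) => //.
by rewrite lexx mulr_gt0 ?pi_gt0.
Qed.

End SphericalField.

Lemma RintegralN {R : realType} {d : measure_display} {S : measurableType d}
    (mu : {measure set S -> \bar R}) (D : set S) (f : S -> R) :
  \int[mu]_(x in D) (- f x) = - \int[mu]_(x in D) f x.
Proof.
rewrite /Rintegral [in RHS]integralE [in LHS]integralE.
rewrite (_ : (fun x => (- f x)%:E) = (\- (EFin \o f))%E)//.
rewrite funeposN funenegN; move: (integral _ _ _) (integral _ _ _) => p q.
by case: p q => [x| |] [y| |] //=; rewrite ?opprB ?oppr0.
Qed.

Lemma gfield_conj {R : realType} {d : measure_display} {Omega : measurableType d}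
    (T : R * R * R -> Omega -> R) (m : int) z w :
  gfield T m z w = conjc (gfield T (- m) z w).
Proof.
rewrite /gfield; apply/eqP; rewrite eq_complex /= !mul0r !subr0 !addr0.
apply/andP; split; apply/eqP.
  congr (_ * _); apply: eq_Rintegral => x _.
  by rewrite !mul0r !subr0 !cosN mulrNz mulNr cosN.
rewrite -mulrN -RintegralN; congr (_ * _); apply: eq_Rintegral => x _.
by rewrite !mul0r !addr0 mulrNz mulNr opprK sinN mulrN.
Qed.

Section FourierModes.
Context {R : realType} {d : measure_display} {Omega : measurableType d}.
Variables (P : probability Omega R) (T : R * R * R -> Omega -> R) (C : nat -> R).
Variable a : nat -> int -> Omega -> R[i].
Hypothesis T_gaussian : gaussian_field P (@sphere R) (fun x w => (T x w)%:C).
Hypothesis C_ge0 : forall l, 0 <= C l.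
Hypothesis coefP : harmonic_coefficients P C a.
Hypothesis expP : forall theta phi : R, 0 <= theta <= pi -> 0 <= phi < 2 * pi ->
  sq_error P T a n theta phi @[n --> \oo] --> 0%E.

Definition gfield_part b m z : Omega -> R := fun w => cpart b (gfield T m%:Z z w).

Lemma gfield_partE b m z : gfield_part b m z =
  fun w => circle_mean (fun x => T (spoint (acos z) x) w * wave b m x).
Proof.
apply/funext => w; rewrite /gfield_part /cpart /gfield /circle_mean.
case: b; rewrite /= mul0r ?subr0 ?addr0; congr (_ * _);
  by apply: eq_Rintegral => x _; rewrite /wave /cpart /= mul0r ?subr0 ?addr0.
Qed.

Section Circle.
Variables (b : bool) (m : nat) (z : R).
Hypothesis z11 : segment11 z.

Let theta := acos z.
Let u x := T (spoint theta x).
Let e n := l2norm P (coef_sum a z n 0 - u 0).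

Let theta_pi : 0 <= theta <= pi.
Proof. by rewrite acos_ge0 ?acos_lepi. Qed.

Let cos_theta : cos theta = z. Proof. exact: acosK. Qed.

Let e_cvg0 : e @ \oo --> 0.
Proof.
by have := l2cvg_coef_sum T_gaussian C_ge0 coefP expP theta_pi (phi := 0);
  rewrite cos_theta; apply; rewrite lexx mulr_gt0 ?pi_gt0.
Qed.

Let remainder_le n x : 0 <= x < 2 * pi ->
  u x - coef_sum a z n x \in L2 P /\ l2norm P (u x - coef_sum a z n x) <= e n.
Proof.
have uL2 y : u y \in L2 P := field_L2 T_gaussian (sphere_spoint theta y).
have SL2 := coef_sum_L2 C_ge0 coefP z n.
move=> x_2pi; split; first exact: rpredB.
have := l2norm_remainder T_gaussian C_ge0 coefP expP n theta_pi x_2pi.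
by rewrite cos_theta -/(u x) -/(u 0) => ->; rewrite l2normBC.
Qed.

Let coef_sum0 : coef_sum a z 0 = fun=> 0.
Proof. by apply/funext => x; rewrite /coef_sum big_nil. Qed.

Let measurable_u : measurable_fun setT (fun p : R * Omega => u p.1 p.2).
Proof. exact: (measurable_field_spoint T_gaussian). Qed.

Let fourier_L2 n := fourier_sum_L2 C_ge0 coefP b m z n.

Let circle_coef_sum n w :
  circle_mean (fun x => coef_sum a z n x w * wave b m x) = fourier_sum a b m z n w.
Proof. exact: mean_coef_sum (circle_mean_exact (n + m)) (leqnn _) w. Qed.

Lemma gfield_part_L2 : gfield_part b m z \in L2 P.
Proof.
rewrite gfield_partE.
exact: (circle_mean_L2 measurable_u coef_sum0 remainder_le
  (@continuous_wave _ b m) (wave_le1 b m)).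
Qed.

Lemma l2cvg_gfield_part : l2cvg P (fourier_sum a b m z) (gfield_part b m z).
Proof.
rewrite gfield_partE.
exact: (l2cvg_circle_mean measurable_u (measurable_coef_sum C_ge0 coefP z)
  (@continuous_coef_sum _ _ _ a z) coef_sum0 remainder_le e_cvg0
  (@continuous_wave _ b m) (wave_le1 b m) fourier_L2 circle_coef_sum).
Qed.

(* The Riemann sums of [n + m + 1] equidistant samples integrate the [n]-th partial sum
   exactly, so they have the same limit as the integrals. *)
Lemma gfield_part_closed_span : l2_closed_span P (@sphere R) T (gfield_part b m z).
Proof.
split; first exact: gfield_part_L2; rewrite gfield_partE.
exists (fun n w => sample_mean (n + m).+1 (fun x => u x w * wave b m x)).
  move=> n; rewrite (_ : (fun w => _) = (n + m).+1%:R^-1 *: \sum_(k < (n + m).+1)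
      wave b m (sample_point (n + m).+1 k) *: u (sample_point (n + m).+1 k)).
    apply/linear_spanZ/linear_span_sum => k; apply/linear_spanZ/linear_span_gen.
    exact: sphere_spoint.
  apply/funext => w; rewrite /sample_mean fct_sumE; congr (_ * _).
  by apply: eq_bigr => k _; rewrite mulrC.
apply: (l2cvg_sample_mean measurable_u (measurable_coef_sum C_ge0 coefP z)
  (@continuous_coef_sum _ _ _ a z) coef_sum0 remainder_le e_cvg0
  (@continuous_wave _ b m) (wave_le1 b m) fourier_L2 circle_coef_sum
  (N := fun n => (n + m).+1)) => // n w.
exact: mean_coef_sum (sample_mean_exact _) (leqnSn _) w.
Qed.

End Circle.

Lemma measurable_gfield_part_ext b m : measurable_fun setT (fun p : R * Omega =>
  circle_mean (fun x => T (spoint ((acos \_ (@segment11 R)) p.1) x) p.2 * wave b m x)).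
Proof.
have macos : measurable_fun setT (acos \_ (@segment11 R)).
  exact: (iffLR (measurable_restrictT _ measurable_segment11) measurable_acos).
have mwave : measurable_fun setT (@wave R b m).
  by apply: continuous_measurable_fun => x; exact: continuous_wave.
pose v (q : R * (R * Omega)) :=
  T (spoint ((acos \_ (@segment11 R)) q.2.1) q.1) q.2.2 * wave b m q.1.
have mv : measurable_fun setT v.
  apply: measurable_funM; last exact: measurableT_comp.
  apply: (measurable_field_spoint T_gaussian) => //.
  - by apply: (measurableT_comp macos); exact: measurableT_comp.
  - exact: (measurableT_comp measurable_snd measurable_snd).
have -> : (fun p : R * Omega => circle_mean
      (fun x => T (spoint ((acos \_ (@segment11 R)) p.1) x) p.2 * wave b m x)) =
    (fun p => \int[circle_prob]_x v (x, p)).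
  apply/funext => p; apply: circle_meanE.
  exact: (measurableT_comp mv (pair2_measurable p)).
exact: measurable_Rintegral_param.
Qed.

Lemma gfield_random m : random_field (@segment11 R) (gfield T m%:Z).
Proof.
apply: eq_measurable_fun (measurable_funTS (measurable_fun_pair
  (measurable_gfield_part_ext false m) (measurable_gfield_part_ext true m))).
move=> [z w]; rewrite inE => -[z11 _] /=; rewrite patchE mem_set//.
have gE b : _ = _ := congr1 (@^~ w) (gfield_partE b m z).
by move: (gE false) (gE true) => /= <- <-.
Qed.

Definition order_index m : set (nat * nat) := [set lm | lm.2 = m /\ (m <= lm.1)%N].

Local Notation coef := (fun lm : nat * nat => a lm.1 lm.2%:Z).

Lemma measurable_fourier_sum_order b m z n :
  @measurable_fun _ _ (g_sigma_algebraType (family_events coef (order_index m))) R setT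
    (fourier_sum a b m z n).
Proof.
have -> : fourier_sum a b m z n = fun w => \sum_(m <= l < n)
    if (m <= l)%N then Llm l m%:Z z * rcoef a (l, m, b) w else 0.
  apply/funext => w; rewrite /fourier_sum fct_sumE big_nat [RHS]big_nat.
  by apply: eq_bigr => l /andP[-> _].
apply: measurable_sum => l; case: (boolP (m <= l)%N) => // ml.
apply: measurable_funM => //; rewrite /rcoef; case: ifP => [_|_ _ U mU].
  exact: measurable_cst.
rewrite setTI; apply: sub_sigma_algebra; exists (l, m), (cproj b @^-1` U).
by split=> //; rewrite -[X in measurable X]setTI; exact: measurable_cproj.
Qed.

Lemma gfield_events_order m :
  field_events (@segment11 R) (gfield T m%:Z) `<=`
  ae_in_sigma P (family_events coef (order_index m)).
Proof.
apply: field_events_ae_in_sigma => z z11.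
  apply: measurable_fun_pair; first exact: measurable_L2 (gfield_part_L2 false m z11).
  exact: measurable_L2 (gfield_part_L2 true m z11).
have ae_gfield_part b := l2cvg_ae_measurable (@measurable_fourier_sum_order b m z)
  (fourier_sum_L2 C_ge0 coefP b m z) (gfield_part_L2 b m z11) (l2cvg_gfield_part b m z11).
have [[re mre reE] [im mim imE]] := (ae_gfield_part false, ae_gfield_part true).
exists (fun w => (re w, im w)); first exact: measurable_fun_pair.
by move: imE; apply: filterS2 reE => w <- <-.
Qed.

Lemma gfield_independent m n : m != n ->
  independent_fields P (@segment11 R) (gfield T m%:Z) (gfield T n%:Z).
Proof.
move=> mn; pose D := [set lm : nat * nat | (lm.2 <= lm.1)%N].
have orderD k : order_index k `<=` D by move=> [l i] [/= ->].
have order_disj : order_index m `&` order_index n = set0.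
  by apply/seteqP; split=> // -[l i] [[/= im _] [/= i_n _]]; rewrite -im -i_n eqxx in mn.
have mcoef lm : D lm -> measurable_fun setT (fun w => cpair (coef lm w)).
  by case: lm => l i; exact: (measurable_coef coefP).
have mevents k : family_events coef (order_index k) `<=` measurable.
  move=> _ [lm [U [lm_k mU ->]]]; rewrite -[X in measurable X]setTI.
  by apply: mcoef => //; exact: orderD lm_k.
move=> A B /gfield_events_order Am /gfield_events_order Bn.
apply: independent_ae_in_sigma (mevents m) (mevents n) _ _ _ Am Bn.
exact: (independent_family_events mcoef (coef_independent coefP)
  (orderD m) (orderD n) order_disj).
Qed.

Lemma cvg_l2dot_gfield_part b b' m z1 z2 : segment11 z1 -> segment11 z2 ->
  (b == b')%:R * wave_sqmean b m *
    \sum_(m <= l < n) C l * Llm l m%:Z z1 * Llm l m%:Z z2 @[n --> \oo] -->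
  l2dot P (gfield_part b m z1) (gfield_part b' m z2).
Proof.
move=> z1_11 z2_11; have fourier_L2 := fourier_sum_L2 C_ge0 coefP.
have := l2cvg_dot (fourier_L2 b m z1) (fourier_L2 b' m z2)
  (gfield_part_L2 b m z1_11) (gfield_part_L2 b' m z2_11)
  (l2cvg_gfield_part b m z1_11) (l2cvg_gfield_part b' m z2_11).
by under eq_cvg do rewrite (l2dot_fourier_sum C_ge0 coefP).
Qed.

Lemma gfield_part_uncorrelated b m z1 z2 : segment11 z1 -> segment11 z2 ->
  l2dot P (gfield_part b m z1) (gfield_part (~~ b) m z2) = 0.
Proof.
have bNb : (b == ~~ b) = false by case: b.
move=> z1_11 z2_11; have := @cvg_l2dot_gfield_part b (~~ b) m _ _ z1_11 z2_11.
under eq_cvg do rewrite bNb !mul0r.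
by move=> /cvg_unique; apply; [exact: Rhausdorff|exact: cvg_cst].
Qed.

Lemma cvg_gfield_covariance m z1 z2 : segment11 z1 -> segment11 z2 ->
  \sum_(m <= l < n) C l * Llm l m%:Z z1 * Llm l m%:Z z2 @[n --> \oo] -->
  l2dot P (gfield_part false m z1) (gfield_part false m z2) +
  l2dot P (gfield_part true m z1) (gfield_part true m z2).
Proof.
move=> z1_11 z2_11.
apply: cvg_trans (cvgD (@cvg_l2dot_gfield_part false false m _ _ z1_11 z2_11)
  (@cvg_l2dot_gfield_part true true m _ _ z1_11 z2_11)).
apply: near_eq_cvg; apply: nearW => n /=.
rewrite fctE !mul1r -mulrDl /wave_sqmean.
by case: ifP => _ /=; field.
Qed.

Lemma gfield_covariance m z1 z2 : segment11 z1 -> segment11 z2 ->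
  let X w := conjc (gfield T m%:Z z1 w) * gfield T m%:Z z2 w in
  let s (n : nat) := \sum_(m <= l < n) C l * Llm l m%:Z z1 * Llm l m%:Z z2 in
  [/\ cintegrable P X, cvgn s & cexpectation P X = (limn s)%:C].
Proof.
move=> z1_11 z2_11 X s; pose g b i := gfield_part b m (if i then z2 else z1).
have gL2 b i : g b i \in L2 P by case: i; exact: gfield_part_L2.
have ig b b' : P.-integrable setT (fun w => (g b false w * g b' true w)%:E).
  exact: integrableM_L2.
have ReX w : complex.Re (X w) =
    g false false w * g false true w + g true false w * g true true w.
  rewrite /X /g /gfield_part /cpart /=.
  by case: (gfield T m%:Z z1 w) => x1 y1; case: (gfield T m%:Z z2 w) => x2 y2 /=; ring.
have ImX w : complex.Im (X w) =
    g false false w * g true true w - g true false w * g false true w.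
  rewrite /X /g /gfield_part /cpart /=.
  by case: (gfield T m%:Z z1 w) => x1 y1; case: (gfield T m%:Z z2 w) => x2 y2 /=; ring.
have cvg_s := cvg_gfield_covariance (m := m) z1_11 z2_11.
split; first split.
- by under eq_fun do rewrite ReX EFinD; exact: integrableD.
- by under eq_fun do rewrite ImX EFinB; exact: integrableB.
- exact: cvgP cvg_s.
rewrite (cvg_lim (@Rhausdorff R) cvg_s) /cexpectation unlock; congr (_ +i* _).
  by under eq_integral do rewrite ReX;
    exact: (RintegralD measurableT (ig false false) (ig true true)).
under eq_integral do rewrite ImX.
apply: etrans (RintegralB measurableT (ig false true) (ig true false)) _.
by rewrite -[LHS]/(l2dot P _ _ - l2dot P _ _) !gfield_part_uncorrelated ?subrr.
Qed.

Hypothesis T_centred : centred_field P (@sphere R) (fun x w => (T x w)%:C).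

Let span_gaussian := field_span_gaussian T_gaussian.

Let field_mean x : sphere x -> \int[P]_w T x w = 0.
Proof.
move=> x_sphere; have [+ _] := T_centred x_sphere.
by rewrite expectation_L2 ?(field_L2 T_gaussian)// => -[].
Qed.

Lemma gfield_gaussian m : gaussian_field P (@segment11 R) (gfield T m%:Z).
Proof.
split=> [|k z b c z11]; first exact: gfield_random.
apply: (l2_closed_span_gaussian span_gaussian field_mean).
rewrite (_ : (fun w => _) = \sum_(j < k)
    (b j *: gfield_part false m (z j) + c j *: gfield_part true m (z j))); last first.
  by apply/funext => w; rewrite fct_sumE.
apply: (l2_closed_span_sum span_gaussian) => j.
by apply: (l2_closed_spanD span_gaussian); apply: (l2_closed_spanZ span_gaussian);
  exact: gfield_part_closed_span.
Qed.

Lemma gfield_centred m : centred_field P (@segment11 R) (gfield T m%:Z).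
Proof.
move=> z z11; have gfield_part_mean b : ('E_P[gfield_part b m z] = 0)%E.
  rewrite expectation_L2 ?gfield_part_L2//; congr EFin.
  exact: (l2_closed_span_mean span_gaussian field_mean (gfield_part_closed_span b m z11)).
by split; [exact: gfield_part_mean false|exact: gfield_part_mean true].
Qed.

End FourierModes.

Theorem lemma2p1 (R : realType) (d : measure_display)
    (Omega : measurableType d) (P : probability Omega R)
    (T : R * R * R -> Omega -> R) (C : nat -> R)
    (M : nat) (kappa : 'I_M -> R[i])
    (T_gaussian : gaussian_field P (@sphere R) (fun x w => (T x w)%:C))
    (T_centred : centred_field P (@sphere R) (fun x w => (T x w)%:C))
    (T_isotropic : weakly_isotropic P 2 T)
    (T_spectrum : angular_power_spectrum P T C)
    (M_gt0 : (0 < M)%N)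
    (kappa_neq0 : forall (i : 'I_M) (l : nat),
       kappa i + (l * (l + 1))%:R != 0)
    (C_form : forall l : nat,
       (C l)%:C = \prod_(i < M) (kappa i + (l * (l + 1))%:R)^-1) :
  [/\ forall m : nat,
        gaussian_field P (@segment11 R) (gfield T m%:Z) /\
        centred_field P (@segment11 R) (gfield T m%:Z),
      forall m n : nat, m != n ->
        independent_fields P (@segment11 R) (gfield T m%:Z) (gfield T n%:Z),
      forall (m : nat) (z1 z2 : R), segment11 z1 -> segment11 z2 ->
        let X w := conjc (gfield T m%:Z z1 w) * gfield T m%:Z z2 w in
        let s (n : nat) :=
          \sum_(m <= l < n) C l * Llm l m%:Z z1 * Llm l m%:Z z2 in
        [/\ cintegrable P X, cvgn s & cexpectation P X = (limn s)%:C] &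
      forall (m : int) (z : R) (w : Omega), m < 0 -> segment11 z ->
        gfield T m z w = conjc (gfield T (- m) z w)].
Proof.
have [C_ge0 _ [a [coefP [_ expP]]]] := T_spectrum.
split=> [m|m n|m z1 z2|m z w _ _].
- split; first exact: (gfield_gaussian T_gaussian C_ge0 coefP expP T_centred).
  exact: (gfield_centred T_gaussian C_ge0 coefP expP T_centred).
- exact: (gfield_independent T_gaussian C_ge0 coefP expP).
- exact: (gfield_covariance T_gaussian C_ge0 coefP expP).
- exact: gfield_conj.
Qed.
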